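(* Let $n,d>1$ and $r\ge 1$ be integers with $2r\leq n+2$, and let $a_1,\ldots,a_r$ be positive integers, all less than $d$. Let $X\subset\mathbb{P}^n$ be a generic hypersurface of degree $d$ over $\mathbb{C}$. Then $X$ contains a $CI(a_1,\ldots,a_r)$ in the following instances, and only in these: \begin{itemize} \item $n=2$, $r=2$: $d$ is arbitrary, and $a_1,a_2$ can assume any value less than $d$; \item $n=3$, $r=2$: $d\leq 3$, and $a_1,a_2$ can assume any value less than $d$; \item $n=4$, $r=3$: $d\leq 5$, and $a_1,a_2,a_3$ can assume any value less than $d$; \item $n=6$, $r=4$, or $n=8$, $r=5$: $d\leq 3$, and $a_1,\ldots,a_r$ can assume any value less than $d$; \item $n=5$, $n=7$ or $n>8$, with $2r=n+1$ or $2r=n+2$: $d=2$ and $a_1=\cdots=a_r=1$ (linear spaces on quadrics). \end{itemize}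
   Context: Let $S=\mathbb{C}[x_0,\ldots,x_n]$ with the standard grading, and let $S_d$ be its degree $d$ part. A $CI(a_1,\ldots,a_r)$ in $\mathbb{P}^n$ is a complete intersection subscheme $Y\subset\mathbb{P}^n$ whose ideal is $I(Y)=(F_1,\ldots,F_r)$, where $F_1,\ldots,F_r\in S$ are forms (homogeneous polynomials) forming a regular sequence with $\deg F_i=a_i$ for all $i$; it need not be reduced. A hypersurface $X$ of degree $d$ with $I(X)=(F)$ contains such a $Y$ if $F\in(F_1,\ldots,F_r)$. ''A generic hypersurface of degree $d$ contains a $CI(a_1,\ldots,a_r)$'' means that there is a nonempty Zariski open subset $U\subset\mathbb{P}(S_d)$ such that for each $[F]\in U$ the hypersurface $F=0$ contains some $CI(a_1,\ldots,a_r)$. *)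

(* Defs.v *)
From mathcomp Require Import all_boot all_order all_algebra.
From mathcomp Require Export complex mpoly reals.

Set Implicit Arguments.
Unset Strict Implicit.
Unset Printing Implicit Defensive.

Import GRing.Theory.
Local Open Scope ring_scope.

Section Ideals.

Variable A : comNzRingType.

Definition in_ideal_lt (r : nat) (F : 'I_r -> A) (k : nat) (G : A) : Prop :=
  exists c : 'I_r -> A, G = \sum_(i < r | (i < k)%N) c i * F i.

Definition in_ideal (r : nat) (F : 'I_r -> A) (G : A) : Prop :=
  exists c : 'I_r -> A, G = \sum_(i < r) c i * F i.

Definition regular_sequence (r : nat) (F : 'I_r -> A) : Prop :=
  (forall (i : 'I_r) (G : A),
     in_ideal_lt F i (F i * G) -> in_ideal_lt F i G) /\
  ~ in_ideal F 1.

End Ideals.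

Section Hypersurfaces.

Variable C : fieldType.
Variable n : nat.

Local Notation S := {mpoly C[n.+1]}.

(* The complete intersection Y is given by its ideal I = I(Y).  For r <= n the
   ideal of a regular sequence of r forms is saturated, so such ideals are
   exactly the I(Y).  Note that a form in a regular sequence is nonzero, hence
   it has exactly the degree required by [.-homog]. *)
Definition is_CI (r : nat) (a : 'I_r -> nat) (I : S -> Prop) : Prop :=
  exists F : 'I_r -> S,
    [/\ forall i, F i \is (a i).-homog,
        regular_sequence F
      & forall G, I G <-> in_ideal F G].

Definition contains_CI (r : nat) (a : 'I_r -> nat) (F : S) : Prop :=
  exists2 I : S -> Prop, is_CI a I & I F.

Definition form_monomial (d : nat) : finType :=
  {m : 'X_{1..n.+1 < d.+1} | mdeg m == d}.

Definition form_coef (d : nat) (F : dhomog n.+1 C d)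
    (i : 'I_#|form_monomial d|) : C :=
  (F : S)@_(val (enum_val i)).

(* A subset of P(S_d) is represented by a predicate on the nonzero F in S_d; its
   values at F = 0 are irrelevant.  The homogeneity of the equations makes an
   open U invariant under scaling. *)
Definition zariski_open (d : nat) (U : dhomog n.+1 C d -> Prop) : Prop :=
  exists2 E : {mpoly C[#|form_monomial d|]} -> Prop,
    (forall e, E e -> exists k : nat, e \is k.-homog)
  & (forall F, F != 0 -> (U F <-> exists2 e, E e & e.@[form_coef F] != 0)).

Definition generic_contains_CI (d r : nat) (a : 'I_r -> nat) : Prop :=
  exists U : dhomog n.+1 C d -> Prop,
    [/\ zariski_open U,
        exists2 F, F != 0 & U F
      & forall F, F != 0 -> U F -> contains_CI a F].

End Hypersurfaces.

(* Main.v *)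
(** Since [F] contains a CI(a_1, ..., a_r) when [F = \sum_i F_i G_i] with
[deg F_i = a_i] and [deg G_i = d - a_i], the question is whether the map
[(F_i, G_i) |-> \sum_i F_i G_i] is dominant.  In characteristic zero this holds
exactly when its differential is onto at some point, that is, when the [2r]
forms [F_i], [G_i] generate all forms of degree [d] for some, hence for generic,
choices (Terracini).

If [2r <= n + 1], generic forms behave like powers of distinct variables, and
these generate degree [d] exactly when [2r = n + 1] and [r (d - 2) < d].  If
[2r = n + 2], the quotient [A] of the polynomial ring by the powers
[x_i ^ e_i] of its [n + 1] variables, taken modulo a power of the sum of the
variables, is controlled by the strong Lefschetz property of [A], proved with
the lowering operator of sl_2 and a positive definite form; conversely, one
more form of degree [b] cannot fill degree [d] when [A_d] is larger than
[A_(d - b)].  The result is [(r - 2) d <= 2r - 1]. *)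
Require Import Defs.
From mathcomp Require Import all_boot all_order all_algebra.
From HB Require Import structures.
From mathcomp Require Import boolp ring zify ssrcomplements.

Set Implicit Arguments.
Unset Strict Implicit.
Unset Printing Implicit Defensive.

Import Order.TTheory GRing.Theory Num.Theory.
Local Open Scope ring_scope.

(** * Algebraic independence and the Jacobian *)

(** Containment is a statement about an open set, Terracini's criterion one about a single point. In
    one direction, generic containment forbids any relation between the coefficients of \sum_i F_i
    G_i, and algebraically independent polynomials have a Jacobian of full rank somewhere. In the
    other, the image has to contain an open set over which, moreover, the F_i can be chosen to form
    a regular sequence. Instead of a general theorem on constructible images, linear forms complete
    the map to one between spaces of equal dimension, whose fibres are governed by one equation per
    variable.

    Failure of spanning has to be shown at a generic point, not at the powers of variables. What
    carries over from the powers is the monomial basis of the quotient: it persists as long as the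
    determinant of [psi_mx] is nonzero.

    The pair of degrees a_i, d - a_i contributes d - 2 to the socle degree, whatever a_i is. If s is
    the socle degree of all forms but the last, of degree b, then s + b - 1 = r (d - 2), and the
    Lefschetz condition s + b <= 2 d becomes (r - 2) d <= 2 r - 1. *)

Lemma mpoly_mulX_ind (R : comNzRingType) n (P : {mpoly R[n]} -> Prop) :
  (forall c, P c%:MP) -> (forall p q, P p -> P q -> P (p + q)) ->
  (forall i p, P p -> P ('X_i * p)) -> forall p, P p.
Proof.
move=> PC PD PX; elim/mpolyind => [|c m p _ _ Pp]; first by rewrite -mpolyC0.
apply: PD => //.
elim: {p Pp} (mdeg m) {-2}m (erefl (mdeg m)) => [|k IHk] {}m.
  by move/eqP; rewrite mdeg_eq0 => /eqP->; rewrite mpolyX0 alg_mpolyC.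
move=> dm; have [i m_i] : exists i, m i != 0%N.
  apply/existsP; rewrite -negb_forall; apply/negP => /forallP m0.
  by have := mdegE m; rewrite dm big1 // => i _; apply/eqP.
have le_m : (U_(i) <= m)%MM by rewrite lep1mP.
have -> : c *: 'X_[m] = 'X_i * (c *: 'X_[m - U_(i)]).
  by rewrite -scalerAr -mpolyXD addmC submK.
apply/PX/IHk.
by have := mdegD (m - U_(i))%MM U_(i); rewrite submK // dm mdeg1 addn1 => -[].
Qed.

Lemma mpoly_ring_ind (R : comNzRingType) n (P : {mpoly R[n]} -> Prop) :
  (forall c, P c%:MP) -> (forall i, P 'X_i) ->
  (forall p q, P p -> P q -> P (p + q)) ->
  (forall p q, P p -> P q -> P (p * q)) -> forall p, P p.
Proof.
by move=> PC PX PD PM; apply: mpoly_mulX_ind => // i p Pp; apply: PM.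
Qed.

Lemma mmap_comp_rmorph (R : comNzRingType) (S S' : comNzRingType) n
    (g : {rmorphism R -> S}) (g' : {rmorphism S -> S'}) (h : 'I_n -> S) p :
  g' (mmap g h p) = mmap (g' \o g) (g' \o h) p.
Proof.
elim/mpoly_ring_ind: p => [c|i|p q|p q]; first by rewrite !mmapC.
- by rewrite !mmapX !mmap1U.
- by move=> Pp Pq; rewrite !rmorphD /= Pp Pq.
- by move=> Pp Pq; rewrite !rmorphM /= Pp Pq.
Qed.

Lemma mmap_ext (R S : nzRingType) n (g g' : R -> S) (h h' : 'I_n -> S) p :
  g =1 g' -> h =1 h' -> mmap g h p = mmap g' h' p.
Proof.
move=> eq_g eq_h; apply: eq_bigr => m _.
by rewrite eq_g (mmap1_eq m eq_h).
Qed.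

Lemma mmap_id (R : comNzRingType) n (p : {mpoly R[n]}) :
  mmap (@mpolyC n R) (fun i => 'X_i) p = p.
Proof.
elim/mpoly_ring_ind: p => [c|i|p q Pp Pq|p q Pp Pq]; first by rewrite mmapC.
- by rewrite mmapX mmap1U.
- by rewrite mmapD Pp Pq.
- by rewrite rmorphM /= Pp Pq.
Qed.

Lemma submm n (m : 'X_{1..n}) : (m - m = 0)%MM.
Proof. by apply/mnmP => k; rewrite mnmBE mnm0E subnn. Qed.

(** The target ring is arbitrary, so that the same chain rule serves for partial derivatives of a
    substitution and for restrictions to a line in [{poly K}]. *)
Lemma mmap_deriv (K : comNzRingType) (S : comNzRingType) n (g : {rmorphism K -> S})
    (h : 'I_n -> S) (D : {additive S -> S}) :
  (forall c, D (g c) = 0) -> (forall a b, D (a * b) = D a * b + a * D b) ->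
  forall p, D (mmap g h p) = \sum_i mmap g h (p^`M(i)) * D (h i).
Proof.
move=> Dg DM; elim/mpoly_mulX_ind => [c|p q Pp Pq|i p Pp].
- by rewrite mmapC Dg big1 // => i _; rewrite mderivC mmap0 mul0r.
- rewrite !raddfD /= Pp Pq -big_split; apply: eq_bigr => i _.
  by rewrite !raddfD /= mulrDl.
- rewrite rmorphM /= DM Pp mmapX mmap1U.
  rewrite (bigD1 i) //= [RHS](bigD1 i) //= mulrDr addrA; congr (_ + _).
    rewrite mderivM mderivX mnm1E eqxx scale1r.
    by rewrite submm mpolyX0 mul1r rmorphD rmorphM /= mmapX mmap1U; ring.
  rewrite mulr_sumr; apply: eq_bigr => k /negbTE ki.
  rewrite mderivM mderivX mnm1E eq_sym ki.
  by rewrite scale0r mul0r add0r rmorphM /= mmapX mmap1U mulrA.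
Qed.


(** * Vanishing of polynomials in characteristic zero *)

Section CharZero.

Variable K : numFieldType.

Lemma poly_vanish (p : {poly K}) : (forall t, p.[t] = 0) -> p = 0.
Proof.
move=> p0; apply/eqP; apply: contraT => nz_p.
have := @max_poly_roots _ p [seq i%:R | i <- iota 0 (size p)] nz_p.
rewrite size_map size_iota ltnn => -> //.
  by apply/allP => _ /mapP [i _ ->]; rewrite /root p0.
rewrite map_inj_uniq ?iota_uniq // => i j /eqP.
by rewrite eqr_nat => /eqP.
Qed.

Lemma mderiv_eq0 n (p : {mpoly K[n]}) :
  (forall i, p^`M(i) = 0) -> p = (p@_0)%:MP.
Proof.
move=> dp; apply/mpolyP => m; rewrite mcoeffC.
have [->|nz_m] := eqVneq m 0%MM; first by rewrite mulr1.
have [i m_i] : exists i, m i != 0%N.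
  apply/existsP; rewrite -negb_forall; apply: contra nz_m => /forallP m0.
  by apply/eqP/mnmP => i; rewrite mnm0E; apply/eqP.
rewrite mulr0; have le_m : (U_(i) <= m)%MM by rewrite lep1mP.
have := mcoeff_deriv i (m - U_(i))%MM p; rewrite dp mcoeff0 submK //.
by move/esym/eqP; rewrite -mulr_natr mulf_eq0 pnatr_eq0 orbF => /eqP.
Qed.

Lemma msize_mderiv n (R : nzRingType) i (p : {mpoly R[n]}) :
  p != 0 -> (msize p^`M(i) < msize p)%N.
Proof.
move=> nz_p; rewrite msizeE.
rewrite (mpolySpred _ nz_p) ltnS.
apply/bigmax_leqP_seq => m; rewrite mcoeff_msupp mcoeff_deriv => nz _.
have : (m + U_(i))%MM \in msupp p.
  by rewrite mcoeff_msupp; apply: contraNneq nz => ->; rewrite mul0rn.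
by move/msize_mdeg_lt; rewrite mdegD mdeg1 addn1 (mpolySpred _ nz_p).
Qed.

(** The restriction of [p] to the line through [v] in direction [i] vanishes, hence so does its
    derivative at [0], the i-th partial derivative of [p] at [v]. By induction on the size all
    partial derivatives are zero. *)
Lemma mpoly_vanish n (p : {mpoly K[n]}) : (forall v, p.@[v] = 0) -> p = 0.
Proof.
elim: {p}(msize p) {-2}p (leqnn (msize p)) => [|k IHk] p le_p p0.
  by apply/eqP; rewrite -msize_poly_eq0 -leqn0.
have [->//|nz_p] := eqVneq p 0.
suff dp i : p^`M(i) = 0.
  have p_const := mderiv_eq0 dp; move: (p0 (fun=> 0)).
  by rewrite p_const mevalC => ->; rewrite mpolyC0.
apply: IHk => [|v]; first by rewrite -ltnS (leq_trans (msize_mderiv _ nz_p)).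
pose h k := (v k)%:P + (k == i)%:R *: 'X : {poly K}.
pose u := mmap polyC h p.
have u0 : u = 0.
  apply: poly_vanish => t; rewrite -horner_evalE /u mmap_comp_rmorph.
  rewrite -[RHS](p0 (fun k => (h k).[t])) /meval.
  apply: eq_bigr => m _; congr (_ * _).
  by rewrite /= horner_evalE hornerC.
have := @mmap_deriv _ _ _ (@polyC K) h (@deriv K) (@derivC K) (@derivM K) p.
rewrite -/u u0 raddf0 (bigD1 i) //= big1 => [|j /negbTE ji]; last first.
  by rewrite /h ji scale0r addr0 derivC mulr0.
rewrite addr0 /h eqxx scale1r derivD derivC derivX add0r mulr1.
move/(congr1 (horner^~ 0)); rewrite -!horner_evalE mmap_comp_rmorph raddf0.
move=> dp0; rewrite [RHS]dp0 /meval; apply: eq_bigr => m _.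
congr (_ * _); first by rewrite /= horner_evalE hornerC.
apply: mmap1_eq => j /=; rewrite horner_evalE hornerD hornerC hornerZ hornerX.
by rewrite mulr0 addr0.
Qed.

Lemma mpoly_neq0_point n (p : {mpoly K[n]}) :
  p != 0 -> exists v, p.@[v] != 0.
Proof.
move=> nz_p; apply: contrapT => no_pt; case/eqP: nz_p.
apply: mpoly_vanish => v; apply/eqP/negPn/negP => pv; apply: no_pt.
by exists v.
Qed.

End CharZero.

Notation mcomp f := (mmap (@mpolyC _ _) f).

Lemma meval_mcomp (K : comNzRingType) m n (f : 'I_m -> {mpoly K[n]}) v p :
  (mcomp f p).@[v] = p.@[fun i => (f i).@[v]].
Proof.
rewrite mmap_comp_rmorph; apply: eq_bigr => k _; congr (_ * _).
by rewrite /= mevalC.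
Qed.

Lemma mderiv_mcomp (K : comNzRingType) m n (f : 'I_m -> {mpoly K[n]}) k p :
  (mcomp f p)^`M(k) = \sum_i mcomp f p^`M(i) * (f i)^`M(k).
Proof.
apply: (@mmap_deriv _ _ _ (@mpolyC n K) f (mderiv k)) => [a|a b].
  exact: mderivC.
exact: mderivM.
Qed.

Definition alg_indep (K : fieldType) m n (f : 'I_m -> {mpoly K[n]}) :=
  forall p, mcomp f p = 0 -> p = 0.

Lemma left_kernel_exists (K : fieldType) m n (A : 'M[K]_(m, n)) :
  (n < m)%N -> exists2 v : 'rV_m, v != 0 & v *m A = 0.
Proof.
move=> lt_nm; exists (nz_row (kermx A)).
  rewrite nz_row_eq0 -mxrank_eq0 mxrank_ker subn_eq0 -ltnNge.
  exact: leq_ltn_trans (rank_leq_col A) lt_nm.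
by apply/sub_kermxP; apply: nz_row_sub.
Qed.

Lemma msizeM_leS (R : idomainType) n (p q : {mpoly R[n]}) k l :
  (msize p <= k.+1 -> msize q <= l.+1 -> msize (p * q) <= (k + l).+1)%N.
Proof.
have [->|nz_p] := eqVneq p 0; first by rewrite mul0r msize0.
have [->|nz_q] := eqVneq q 0; first by rewrite mulr0 msize0.
by rewrite msizeM //; move: (mmeasure _ p) (mmeasure _ q) => a b; lia.
Qed.

Lemma msize_exp_le (R : idomainType) n (p : {mpoly R[n]}) e k :
  (msize p <= e.+1 -> msize (p ^+ k) <= (k * e).+1)%N.
Proof.
move=> lep; elim: k => [|k IHk]; first by rewrite expr0 msize1.
by rewrite exprS mulSn msizeM_leS.
Qed.

Lemma msize_prod_le (R : idomainType) n I (s : seq I) (F : I -> {mpoly R[n]})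
    (e : I -> nat) :
  (forall i, msize (F i) <= (e i).+1)%N ->
  (msize (\prod_(i <- s) F i) <= (\sum_(i <- s) e i).+1)%N.
Proof.
move=> leF; elim/big_ind2: _ => // [|k p l q]; first by rewrite msize1.
exact: msizeM_leS.
Qed.

(* Monomials of degree [< D] in each of [m] variables outnumber, for large [D],
   the monomials available in the values of a substitution into [n < m]
   variables, since [D ^ m] grows faster than [(c * D) ^ n]. *)
Lemma alg_indep_leq (K : fieldType) m n (f : 'I_m -> {mpoly K[n]}) :
  alg_indep f -> (m <= n)%N.
Proof.
move=> f_indep; rewrite leqNgt; apply/negP => lt_nm.
pose e := (\max_i msize (f i))%N.
have lef i : (msize (f i) <= e.+1)%N by apply/leqW/leq_bigmax.
(* With [c = (m * e).+1] one has [B <= c * D], so [B ^ n <= c ^ n * D ^ n < D ^ n.+1 <= D ^ m]: it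
   is enough that [D] exceeds [c ^ n]. *)
pose D := ((m * e).+1 ^ n).+1; pose B := (m * e * D).+1.
pose T := {ffun 'I_m -> 'I_D}; pose T' := {ffun 'I_n -> 'I_B}.
pose mon (a : T) := [multinom (a i : nat) | i < m].
pose mon' (b : T') := [multinom (b i : nat) | i < n].
pose F a := mcomp f 'X_[mon a].
have szF a : (msize (F a) <= B)%N.
  rewrite /F mmapX /mmap1.
  apply: leq_trans (@msize_prod_le _ _ _ _ _ (fun i => a i * e)%N _) _.
    by move=> i; rewrite mnmE; apply: msize_exp_le.
  rewrite ltnS -big_distrl /= mulnAC leq_mul2r; apply/orP; right.
  rewrite -[X in (_ <= X * _)%N]card_ord -sum_nat_const; apply: leq_sum => i _.
  exact/ltnW.
pose A := \matrix_(i < #|{: T}|, j < #|{: T'}|)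
  (F (enum_val i))@_(mon' (enum_val j)).
have [|v nz_v vA] := left_kernel_exists A.
  rewrite !card_ffun !card_ord.
  have leB : (B <= (m * e).+1 * D)%N by rewrite mulSn /B; lia.
  apply: (@leq_ltn_trans (((m * e).+1 * D) ^ n)%N).
    by case: (n) => // n'; rewrite leq_exp2r.
  rewrite expnMn; apply: (@leq_trans (D * D ^ n)).
    by rewrite ltn_pmul2r ?expn_gt0.
  by rewrite -expnS leq_pexp2l.
pose p := \sum_(i < #|{: T}|) v 0 i *: 'X_[mon (enum_val i)].
have mon_inj : injective mon.
  move=> a b /mnmP ab; apply/ffunP => i; apply/val_inj.
  by have := ab i; rewrite !mnmE.
case/eqP: nz_v; apply/rowP => i; rewrite mxE.
have p0 : p = 0.
  apply: f_indep; rewrite raddf_sum /=.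
  pose q := \sum_(i < #|{: T}|) v 0 i *: F (enum_val i).
  have -> : \sum_(i < #|{: T}|) mcomp f (v 0 i *: 'X_[mon (enum_val i)]) = q.
    by apply: eq_bigr => j _; rewrite mmapZ mul_mpolyC.
  apply/mpolyP => b; rewrite mcoeff0.
  have [lt_b|le_b] := ltnP (mdeg b) B; last first.
    rewrite raddf_sum big1 //= => j _; rewrite mcoeffZ.
    by rewrite (memN_msupp_eq0 (msize_mdeg_ge (leq_trans (szF _) le_b))) mulr0.
  have ltb j : (b j < B)%N.
    by apply: leq_ltn_trans lt_b; rewrite mdegE (bigD1 j) //= leq_addr.
  pose b' : T' := [ffun j => Ordinal (ltb j)].
  have -> : b = mon' b' by apply/mnmP => j; rewrite mnmE ffunE.
  have /rowP/(_ (enum_rank b')) := vA; rewrite !mxE => <-.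
  rewrite raddf_sum; apply: eq_bigr => j _ /=.
  by rewrite mcoeffZ mxE enum_rankK.
have := congr1 (mcoeff (mon (enum_val i))) p0.
rewrite mcoeff0 raddf_sum (bigD1 i) //= mcoeffZ mcoeffX eqxx mulr1.
rewrite big1 ?addr0 // => j ji; rewrite mcoeffZ mcoeffX.
by rewrite (inj_eq mon_inj) (inj_eq enum_val_inj) (negbTE ji) mulr0.
Qed.

Section AlgebraicRelations.

Variable K : numFieldType.

Local Notation pcomp f P := (map_poly (mcomp f) P).

Definition mcons m n (f : 'I_m -> {mpoly K[n]}) (g : {mpoly K[n]}) :
    'I_m.+1 -> {mpoly K[n]} :=
  fun i => oapp f g (unlift ord_max i).

Definition munlast m : {mpoly K[m.+1]} -> {poly {mpoly K[m]}} :=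
  mmap (polyC \o @mpolyC m K)
    (fun i => oapp (fun j => ('X_j)%:P) 'X (unlift ord_max i)).

Lemma mcomp_mcons m n (f : 'I_m -> {mpoly K[n]}) g p :
  mcomp (mcons f g) p = (pcomp f (munlast p)).[g].
Proof.
pose phi : {rmorphism _ -> _} := horner_eval g \o map_poly (mcomp f).
rewrite -[RHS]/(phi (munlast p)) [RHS]mmap_comp_rmorph.
apply: mmap_ext => [c|i]; rewrite /= horner_evalE.
  by rewrite map_polyC hornerC /= mmapC.
rewrite /mcons; case: (unlift _ _) => [j|] /=.
  by rewrite map_polyC hornerC /= mmapX mmap1U.
by rewrite map_polyX hornerX.
Qed.

Lemma munlast_eq0 m (p : {mpoly K[m.+1]}) : munlast p = 0 -> p = 0.
Proof.
move=> p0; rewrite -[p]mmap_id.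
have -> : mcomp (fun i => 'X_i) p =
    mcomp (mcons (fun j => 'X_(lift ord_max j)) 'X_ord_max) p.
  apply: mmap_ext => // i; rewrite /mcons.
  by case: (unliftP ord_max i) => [j ->|->] /=; rewrite ?liftK ?unlift_none.
by rewrite mcomp_mcons p0 rmorph0 horner0.
Qed.

Definition algebraic_over m n (f : 'I_m -> {mpoly K[n]}) (g : {mpoly K[n]}) :=
  exists2 P : {poly {mpoly K[m]}}, P != 0 & (pcomp f P).[g] = 0.

Lemma algebraic_over_mcons m n (f : 'I_m -> {mpoly K[n]}) g :
  ~ alg_indep (mcons f g) -> algebraic_over f g.
Proof.
move/existsNP => [p /not_implyP [p0 nz_p]]; exists (munlast p).
  by apply/eqP => /munlast_eq0.
by rewrite -mcomp_mcons.
Qed.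

(** Minimality is used twice: the derivative of [P] is shorter, so it does not vanish at [g]; and if
    [g != 0] the constant coefficient of [P] is nonzero, as otherwise a factor ['X] could be
    removed. *)
Lemma minimal_relation m n (f : 'I_m -> {mpoly K[n]}) g :
  alg_indep f -> algebraic_over f g ->
  exists P : {poly {mpoly K[m]}},
    [/\ (1 < size P)%N, (pcomp f P).[g] = 0
      & forall Q : {poly {mpoly K[m]}}, Q != 0 -> (size Q < size P)%N ->
        (pcomp f Q).[g] != 0].
Proof.
move=> f_indep [P0 nz_P0 P0g].
have ex_k : exists k, `[< exists P : {poly {mpoly K[m]}},
    [/\ size P = k, P != 0 & (pcomp f P).[g] = 0] >].
  by exists (size P0); apply/asboolP; exists P0.
case: (ex_minnP ex_k) => k /asboolP [P [szP nz_P Pg]] min_k.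
exists P; split=> // [|Q nz_Q lt_QP].
  rewrite ltnNge; apply/negP => /size1_polyC P_const; move: Pg nz_P.
  rewrite P_const map_polyC hornerC polyC_eq0 => /eqP.
  by move=> /eqP/f_indep ->; rewrite eqxx.
apply: contraL lt_QP => /eqP Qg; rewrite -leqNgt szP min_k //.
by apply/asboolP; exists Q.
Qed.

Lemma map_mderivMXaddC m i (P : {poly {mpoly K[m]}}) c :
  map_poly (mderiv i) (P * 'X + c%:P) =
  map_poly (mderiv i) P * 'X + (c^`M(i))%:P.
Proof.
have coefm (Q : {poly {mpoly K[m]}}) l :
    (map_poly (mderiv i) Q)`_l = (Q`_l)^`M(i).
  by apply: coef_map_id0; apply: mderiv0.
have coefX (Q : {poly {mpoly K[m]}}) b l :
    (Q * 'X + b%:P)`_l = if l is l'.+1 then Q`_l' else b.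
  by rewrite coefD coefMX coefC; case: l => [|l] /=; rewrite ?add0r ?addr0.
apply/polyP => l.
apply: etrans (coefm _ _) _.
apply: etrans (congr1 (mderiv i) (coefX P c l)) _.
apply: etrans (esym (coefX _ _ l)).
case: l => [//|l].
exact: esym (coefm _ _).
Qed.

Lemma mderiv_relation m n (f : 'I_m -> {mpoly K[n]}) g k P :
  ((pcomp f P).[g])^`M(k) =
    (pcomp f P^`()).[g] * g^`M(k)
    + \sum_i (pcomp f (map_poly (mderiv i) P)).[g] * (f i)^`M(k).
Proof.
elim/poly_ind: P => [|P c IHP].
  rewrite deriv0 !rmorph0 !horner0 mderiv0 mul0r add0r big1 // => i _.
  by rewrite !raddf0 horner0 mul0r.
rewrite rmorphD rmorphM /= map_polyX map_polyC /= hornerMXaddC.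
rewrite mderivD mderivM IHP derivD derivM derivX derivC mulr1 addr0.
rewrite rmorphD rmorphM /= map_polyX hornerD hornerMX.
rewrite mderiv_mcomp mulrDl mulr_suml.
rewrite [in RHS](_ : \sum_(i < m) _ = \sum_(i < m)
   ((pcomp f (map_poly (mderiv i) P)).[g] * (f i)^`M(k) * g
    + mcomp f c^`M(i) * (f i)^`M(k))); last first.
  apply: eq_bigr => i _.
  rewrite map_mderivMXaddC.
  rewrite rmorphD rmorphM /= map_polyX map_polyC /= hornerMXaddC; ring.
rewrite big_split /=; ring.
Qed.

Definition jacobian m n (f : 'I_m -> {mpoly K[n]}) (v : 'I_n -> K) :
  'M[K]_(m, n) := \matrix_(i, j) ((f i)^`M(j)).@[v].

Lemma mpoly_natr_neq0 m k : (k.+1%:R : {mpoly K[m]}) != 0.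
Proof. by rewrite -mpolyC_nat mpolyC_eq0 pnatr_eq0. Qed.

Lemma deriv_eq0_size m (P : {poly {mpoly K[m]}}) : P^`() = 0 -> (size P <= 1)%N.
Proof.
move=> dP; apply/leq_sizeP => -[//|j] _; apply/eqP.
have /polyP/(_ j)/eqP := dP; rewrite coef_deriv coef0 -mulr_natr mulf_eq0.
by rewrite (negbTE (mpoly_natr_neq0 _ _)) orbF.
Qed.

Lemma jacobian_row_free_of_algebraic m n (f : 'I_m -> {mpoly K[n]}) :
  alg_indep f -> (forall j, algebraic_over f 'X_j) ->
  exists v, row_free (jacobian f v).
Proof.
move=> f_indep alg_X.
have /fin_all_exists [P minP] j := minimal_relation f_indep (alg_X j).
pose d j := (pcomp f (P j)^`()).['X_j].
have nz_d j : d j != 0.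
  have [szP _ minPj] := minP j; apply: minPj.
    apply: contraTneq szP => dP0; rewrite -leqNgt.
    by rewrite (size1_polyC (deriv_eq0_size dP0)) size_polyC; case: (_ != _).
  by rewrite lt_size_deriv // -size_poly_gt0 ltnW.
have [v] : exists v, (\prod_j d j).@[v] != 0.
  by apply: mpoly_neq0_point; apply/prodf_neq0.
rewrite rmorph_prod /= => /prodf_neq0 nz_dv; exists v.
pose B : 'M[K]_(n, m) :=
  \matrix_(j, i) - ((pcomp f (map_poly (mderiv i) (P j))).['X_j]).@[v].
(* Row [j] is the relation of ['X_j], differentiated in all directions and evaluated at [v]. *)
have BJ : B *m jacobian f v = diag_mx (\row_j (d j).@[v]).
  apply/matrixP => j k; rewrite !mxE.
  have [_ Pj _] := minP j; have := mderiv_relation f 'X_j k (P j).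
  rewrite Pj mderiv0 mderivX mnm1E -/(d j) => /esym/(congr1 (meval v)).
  rewrite rmorph0 rmorphD rmorphM /= raddf_sum /= mevalZ.
  have -> : (j == k)%:R * ('X_[(U_(j) - U_(k))] : {mpoly K[n]}).@[v]
            = (j == k)%:R.
    case: eqP => [->|]; last by rewrite mul0r.
    by rewrite submm mpolyX0 meval1 mulr1.
  move/eqP; rewrite addr_eq0 => /eqP; rewrite mulr_natr => ->.
  rewrite -sumrN; apply: eq_bigr => i _; rewrite !mxE rmorphM /=.
  by rewrite mulNr.
(* The product with [B] is invertible, so the rank is at least [n], and [n] is at least [m] by
   independence. *)
have rk : (n <= \rank (jacobian f v))%N.
  apply: leq_trans (mxrankM_maxr B _); rewrite BJ mxrank_unit //.
  rewrite unitmxE det_diag unitfE; apply/prodf_neq0 => j _.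
  by rewrite mxE nz_dv.
apply/eqP/anti_leq; rewrite rank_leq_row.
exact: leq_trans (alg_indep_leq f_indep) rk.
Qed.

(* Adjoining variables to [f] as long as this preserves independence, all
   variables become algebraic; differentiating their minimal relations then
   expresses every [dx_j] through the differentials of the family. *)
Lemma alg_indep_jacobian m n (f : 'I_m -> {mpoly K[n]}) :
  alg_indep f -> exists v, row_free (jacobian f v).
Proof.
elim: {m}(n - m)%N {-2}m (leqnn (n - m)) f => [|k IHk] m le_k f f_indep;
  have [alg_X|/existsNP [j not_alg]] := EM (forall j, algebraic_over f 'X_j);
  try exact: jacobian_row_free_of_algebraic;
  have g_indep : alg_indep (mcons f 'X_j) by
    apply: contrapT => /algebraic_over_mcons.
- by have := alg_indep_leq g_indep; move: le_k; lia.
have [|v] := IHk m.+1 _ _ g_indep; first by move: le_k; lia.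
case/row_freeP => B JB; exists v; apply/row_freeP.
exists (colsub (lift ord_max) B); apply/matrixP => a b.
have /matrixP/(_ (lift ord_max a) (lift ord_max b)) := JB.
rewrite !mxE (inj_eq lift_inj) => <-; apply: eq_bigr => c _.
by rewrite !mxE /mcons liftK.
Qed.

(** If [p] is a relation, the row of its partial derivatives at [f] is killed by the Jacobian
    matrix, hence zero since the determinant is a nonzero polynomial. The partial derivatives are
    thus shorter relations, zero by induction, and [p] is constant. *)
Lemma alg_indep_of_jacobian n (f : 'I_n -> {mpoly K[n]}) v :
  jacobian f v \in unitmx -> alg_indep f.
Proof.
rewrite unitmxE unitfE => nz_det.
pose J := \matrix_(i, j) (f i)^`M(j).
have nz_J : \det J != 0.
  apply: contraNneq nz_det => J0.
  rewrite (_ : jacobian f v = map_mx (meval v) J) ?det_map_mx ?J0 ?rmorph0 //.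
  by apply/matrixP => i j; rewrite !mxE.
move=> p; elim: {p}(msize p) {-2}p (leqnn (msize p)) => [|k IHk] p le_p fp.
  by apply/eqP; rewrite -msize_poly_eq0 -leqn0.
have [->//|nz_p] := eqVneq p 0.
pose u : 'rV_n := \row_i mcomp f p^`M(i).
have uJ : u *m J = 0.
  apply/rowP => j; rewrite !mxE.
  transitivity (mcomp f p)^`M(j); last by rewrite fp mderiv0.
  by rewrite mderiv_mcomp; apply: eq_bigr => i _; rewrite !mxE.
have u0 : u = 0.
  have : \det J *: u = 0 by rewrite -mul_mx_scalar -mul_mx_adj mulmxA uJ mul0mx.
  move/rowP => detu; apply/rowP => i; move: (detu i); rewrite !mxE => /eqP.
  by rewrite mulf_eq0 (negbTE nz_J) => /eqP.
have dp i : p^`M(i) = 0.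
  apply: IHk; first by rewrite -ltnS (leq_trans (msize_mderiv _ nz_p)).
  by have /rowP/(_ i) := u0; rewrite !mxE.
rewrite (mderiv_eq0 dp) in fp *; move: fp; rewrite mmapC => /eqP.
by rewrite mpolyC_eq0 => /eqP ->; rewrite mpolyC0.
Qed.

End AlgebraicRelations.

(** * Dominant polynomial maps *)

Section IdealPoint.

Variables (K : closedFieldType) (n : nat).
Implicit Types (I : {mpoly K[n]} -> Prop) (g : {mpoly K[n]}).

Definition is_ideal I :=
  [/\ I 0, forall g h, I g -> I h -> I (g + h) & forall a g, I g -> I (a * g)].

Definition adjoin I g h := exists a, exists2 b, I b & h = a * g + b.

Lemma adjoin_ideal I g : is_ideal I -> is_ideal (adjoin I g).
Proof.
case=> I0 ID IM; split.
- by exists 0, 0; rewrite // mul0r addr0.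
- move=> _ _ [a [b Ib ->]] [a' [b' Ib' ->]]; exists (a + a'), (b + b').
    exact: ID.
  ring.
- move=> c _ [a [b Ib ->]]; exists (c * a), (c * b); first exact: IM.
  ring.
Qed.

Lemma adjoin_sub I g h : I h -> adjoin I g h.
Proof. by exists 0, h; rewrite // mul0r add0r. Qed.

Lemma adjoin_gen I g : is_ideal I -> adjoin I g g.
Proof. by case=> I0 _ _; exists 1, 0; rewrite // mul1r addr0. Qed.

(** If 1 = a h + b with [b] in [I], a factor [h] of a product in [I] can be cancelled modulo [I];
    cancelling all of them would put [1] in [I]. *)
Lemma ideal_split I (s : seq {mpoly K[n]}) : is_ideal I -> ~ I 1 ->
  I (\prod_(h <- s) h) -> exists2 h, h \in s & ~ adjoin I h 1.
Proof.
move=> idI properI; elim: s => [|h s IHs]; first by rewrite big_nil.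
rewrite big_cons => Ihs.
have [h1|] := EM (adjoin I h 1); last by exists h; rewrite ?mem_head.
have [|k sk nk] := IHs; last by exists k; rewrite // inE sk orbT.
case: idI => _ ID IM; case: h1 => a [b Ib e1]; rewrite -[\prod_(_ <- _) _]mul1r.
rewrite [X in X * _]e1 mulrDl -mulrA; apply: ID; first exact: IM.
by rewrite mulrC; apply: IM.
Qed.

(** A Nullstellensatz for ideals containing a univariate polynomial in each variable. This
    polynomial splits, so some factor ['X_j - z] can be adjoined with the ideal still proper; once
    every variable is constant modulo the ideal, so is every polynomial. *)
Lemma ideal_point I : is_ideal I -> ~ I 1 ->
  (forall j, exists2 u : {poly K}, u != 0 & I (map_poly (@mpolyC n K) u).['X_j]) ->
  exists v, forall g, I g -> g.@[v] = 0.
Proof.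
move=> idI properI alg_X.
have step (k : nat) : exists J, [/\ is_ideal J, ~ J 1, forall g, I g -> J g
    & forall j : 'I_n, (j < k)%N -> exists c, J ('X_j - c%:MP)].
  elim: k => [|k [J [idJ properJ sIJ JX]]]; first by exists I.
  have [lt_kn|le_nk] := ltnP k n; last first.
    exists J; split=> // j _; apply: JX.
    exact: leq_trans (ltn_ord j) le_nk.
  pose j0 := Ordinal lt_kn.
  have [u nz_u /sIJ] := alg_X j0.
  have [s ->] := closed_field_poly_normal u.
  rewrite map_polyZ rmorph_prod hornerZ horner_prod /=.
  have -> : \prod_(z <- s) (map_poly (mpolyC n (R:=K)) ('X - z%:P)).['X_j0]
      = \prod_(h <- [seq 'X_j0 - z%:MP | z <- s]) h :> {mpoly K[n]}.
    rewrite big_map; apply: eq_bigr => z _.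
    by rewrite rmorphB /= map_polyX map_polyC hornerXsubC.
  case: (idJ) => _ _ JM /(JM (lead_coef u)^-1%:MP_[n]).
  rewrite mulrA -mpolyCM mulVf ?lead_coef_eq0 // mpolyC1 mul1r.
  case/(ideal_split idJ properJ) => _ /mapP [z _ ->] proper'.
  exists (adjoin J ('X_j0 - z%:MP)); split=> //.
  - exact: adjoin_ideal.
  - by move=> g /sIJ; apply: adjoin_sub.
  - move=> j; rewrite ltnS leq_eqVlt => /orP [/eqP jk|/JX [c Jc]].
      have -> : j = j0 by apply: val_inj.
      by exists z; apply: adjoin_gen.
    by exists c; apply: adjoin_sub.
have [J [[J0 JD JM] properJ sIJ JX]] := step n.
have /fin_all_exists [v Jv] (j : 'I_n) := JX j (ltn_ord j).
exists v => g /sIJ Jg.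
have Jgv h : J (h - h.@[v]%:MP).
  elim/mpoly_ring_ind: h => [c|i|p q Jp Jq|p q Jp Jq].
  - by rewrite mevalC subrr.
  - by rewrite mevalXU.
  - by rewrite mevalD mpolyCD opprD addrACA; apply: JD.
  - rewrite mevalM mpolyCM.
    have -> : p * q - p.@[v]%:MP * q.@[v]%:MP =
      q * (p - p.@[v]%:MP) + p.@[v]%:MP * (q - q.@[v]%:MP) by ring.
    by apply: JD; apply: JM.
apply/eqP; apply: contra_notT properJ => nz_gv.
have Jc : J g.@[v]%:MP.
  have -> : g.@[v]%:MP = g + (-1) * (g - g.@[v]%:MP) by ring.
  by apply: JD => //; apply: JM.
have -> : 1 = (g.@[v]^-1)%:MP * g.@[v]%:MP :> {mpoly K[n]}.
  by rewrite -mpolyCM mulVf // mpolyC1.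
exact: JM.
Qed.

End IdealPoint.

(** * Fibres of a map between affine spaces of equal dimension *)

Section ImageOpen.

Variables (K : numClosedFieldType) (n : nat) (f : 'I_n -> {mpoly K[n]}).
Hypothesis f_indep : alg_indep f.

Local Notation F := (mcomp f).
Local Notation pcomp P := (map_poly F P).

Lemma square_algebraic g : algebraic_over f g.
Proof.
apply: algebraic_over_mcons => /alg_indep_leq.
by rewrite ltnn.
Qed.

(** Powers of ['X] pad the relations to a common degree [D.+1], so that one range of exponents
    serves for all variables. *)
Lemma relations_of_equal_size : exists D, exists P : 'I_n -> {poly {mpoly K[n]}},
  forall j, size (P j) = D.+2 /\ (pcomp (P j)).['X_j] = 0.
Proof.
have /fin_all_exists [Q Qj] (j : 'I_n) : exists Q : {poly {mpoly K[n]}},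
    Q != 0 /\ (pcomp Q).['X_j] = 0.
  by have [Q nzQ Q0] := square_algebraic 'X_j; exists Q.
pose D := \max_j size (Q j).
exists D, (fun j => Q j * 'X^(D.+2 - size (Q j))) => j.
have [nzQ Q0] := Qj j; split.
  have leD : (size (Q j) <= D)%N by apply: (leq_bigmax j).
  by rewrite size_mulXn //; move: leD; lia.
by rewrite rmorphM hornerM /= Q0 mul0r.
Qed.

Section Lift.

Variables (D : nat) (P : 'I_n -> {poly {mpoly K[n]}}).
Hypothesis szP : forall j, size (P j) = D.+2.
Hypothesis P0 : forall j, (pcomp (P j)).['X_j] = 0.

Let T := {ffun 'I_n -> 'I_D.+1}.
Let mon (a : T) := [multinom (a i : nat) | i < n].
Let c0 := \prod_j lead_coef (P j).

(** Membership in the K[f]-span of the monomials [mon a] after inverting [F c0]; the denominator is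
    kept as an explicit power instead of localising. *)
Definition spanned g := exists k, exists A : T -> {mpoly K[n]},
  F c0 ^+ k * g = \sum_a F (A a) * 'X_[mon a].

Lemma spanned_raise k k' g (A : T -> {mpoly K[n]}) : (k <= k')%N ->
  F c0 ^+ k * g = \sum_a F (A a) * 'X_[mon a] ->
  F c0 ^+ k' * g = \sum_a F (c0 ^+ (k' - k) * A a) * 'X_[mon a].
Proof.
move=> le_k eA; rewrite -{1}(subnK le_k) exprD -mulrA eA mulr_sumr.
by apply: eq_bigr => a _; rewrite rmorphM rmorphXn /= mulrA.
Qed.

Lemma spanned_basis a : spanned 'X_[mon a].
Proof.
exists 0, (fun b => (b == a)%:R); rewrite expr0 mul1r (bigD1 a) //= eqxx.
rewrite rmorph1 mul1r big1 ?addr0 // => b /negbTE ->.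
by rewrite rmorph0 mul0r.
Qed.

Lemma spannedZ p g : spanned g -> spanned (F p * g).
Proof.
case=> k [A eA]; exists k, (fun a => p * A a).
rewrite mulrCA eA mulr_sumr; apply: eq_bigr => a _.
by rewrite rmorphM /= mulrA.
Qed.

Lemma spanned_sum I (r : seq I) (Q : pred I) (g : I -> {mpoly K[n]}) :
  (forall i, Q i -> spanned (g i)) -> spanned (\sum_(i <- r | Q i) g i).
Proof.
move=> sp_g; elim/big_ind: _ => // [|p q [k [A eA]] [l [B eB]]].
  exists 0, (fun=> 0); rewrite mulr0 big1 // => a _.
  by rewrite rmorph0 mul0r.
exists (k + l)%N, (fun a => c0 ^+ (k + l - k) * A a + c0 ^+ (k + l - l) * B a).
rewrite mulrDr (spanned_raise (leq_addr l k) eA).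
rewrite (spanned_raise (leq_addl k l) eB) -big_split; apply: eq_bigr => a _.
by rewrite rmorphD mulrDl.
Qed.

Lemma spanned_div k g : spanned (F c0 ^+ k * g) -> spanned g.
Proof. by case=> l [A eA]; exists (l + k)%N, A; rewrite exprD -mulrA. Qed.

(** The product leaves the box only when the exponent reaches [D.+1]. The relation of ['X_j] then
    rewrites its leading coefficient times ['X_j ^+ D.+1] by lower powers, and that coefficient is a
    factor of [c0]. *)
Lemma spanned_mulX_basis j a : spanned ('X_j * 'X_[mon a]).
Proof.
pose upd (l : 'I_D.+1) : T := [ffun i => if i == j then l else a i].
pose m0 := [multinom (if i == j then 0 else a i : nat)%N | i < n].
have monE l : mon (upd l) = (U_(j) *+ l + m0)%MM.
  apply/mnmP => i; rewrite mnmDE mulmnE mnm1E !mnmE ffunE eq_sym.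
  by case: ifP; rewrite ?mul1n ?addn0 ?mul0n.
have monaE : mon a = (U_(j) *+ a j + m0)%MM.
  by rewrite -monE; congr mon; apply/ffunP => i; rewrite ffunE; case: eqP => [->|].
have -> : 'X_j * 'X_[mon a] = 'X_j ^+ (a j).+1 * 'X_[m0] :> {mpoly K[n]}.
  by rewrite monaE mpolyXD mpolyXn mulrA -mpolyXD mulmS.
have [lt_D|le_D] := ltnP (a j).+1 D.+1.
  have := spanned_basis (upd (Ordinal lt_D)).
  by rewrite monE /= mpolyXD mpolyXn.
have -> : (a j).+1 = D.+1 by apply/anti_leq; rewrite le_D ltn_ord.
apply: (@spanned_div 1); rewrite expr1 /c0 (bigD1 j) //= rmorphM /=.
set c' := F (\prod_(_ | _) _).
have -> : F (lead_coef (P j)) * c' * ('X_j ^+ D.+1 * 'X_[m0]) =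
   c' * ((F (lead_coef (P j)) * 'X_j ^+ D.+1) * 'X_[m0]) by ring.
have -> : F (lead_coef (P j)) * 'X_j ^+ D.+1 =
    - \sum_(l < D.+1) F (P j)`_l * 'X_j ^+ l.
  apply/eqP; rewrite -addr_eq0 addrC lead_coefE szP /=; apply/eqP.
  apply: etrans (P0 j); rewrite (@horner_coef_wide _ D.+2); last first.
    by rewrite -(szP j) size_poly.
  rewrite [RHS]big_ord_recr /=; congr (_ + _); last by rewrite coef_map.
  by apply: eq_bigr => l _; rewrite coef_map.
rewrite mulNr mulrN -mulN1r.
have -> : -1 = F (-1) :> {mpoly K[n]} by rewrite rmorphN1.
apply/spannedZ/spannedZ; rewrite mulr_suml; apply: spanned_sum => l _.
by rewrite -mulrA mpolyXn -mpolyXD -monE; apply/spannedZ/spanned_basis.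
Qed.

Lemma all_spanned g : spanned g.
Proof.
elim/mpoly_mulX_ind: g => [c|p q sp sq|j p [k [A eA]]].
- have := spannedZ c%:MP (spanned_basis [ffun=> ord0]).
  rewrite mmapC (_ : mon _ = 0%MM) ?mpolyX0 ?mulr1 //.
  by apply/mnmP => i; rewrite mnmE ffunE mnm0E.
- have := @spanned_sum bool [:: true; false] xpredT (fun b => if b then p else q).
  by rewrite big_cons big_seq1 /=; apply=> -[].
- apply: (@spanned_div k); rewrite mulrCA eA mulr_sumr.
  apply: spanned_sum => a _; rewrite mulrCA.
  exact/spannedZ/spanned_mulX_basis.
Qed.

Definition fibre_ideal (y : 'I_n -> K) (g : {mpoly K[n]}) :=
  exists h : 'I_n -> {mpoly K[n]}, g = \sum_i h i * (f i - (y i)%:MP).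

(* If [1 = \sum_i h_i (f_i - y_i)], then multiplication by [1], written in the
   spanning monomials, gives a matrix over [K[f]] that annihilates them but
   whose determinant specialises at [y] to a power of [c0 y]. *)
Lemma fibre_ideal_proper y : c0.@[y] != 0 -> ~ fibre_ideal y 1.
Proof.
move=> nz_c0 [h e1].
have /fin_all_exists [k /= kP] (s : 'I_n * T) := all_spanned (h s.1 * 'X_[mon s.2]).
pose k0 := (\max_s k s)%N.
have /fin_all_exists [A /= AP] (s : 'I_n * T) : exists A : T -> {mpoly K[n]},
    F c0 ^+ k0 * (h s.1 * 'X_[mon s.2]) = \sum_a F (A a) * 'X_[mon a].
  have [A eA] := kP s.
  by eexists; apply: spanned_raise eA; apply: leq_bigmax.
pose N := #|{: T}|.
have sumT (G : T -> {mpoly K[n]}) : \sum_a G a = \sum_(b < N) G (enum_val b).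
  by rewrite (reindex (@enum_val T predT)) //; apply/onW_bij/enum_val_bij.
pose B : 'M[{mpoly K[n]}]_N := \matrix_(a, b)
  \sum_i ('X_i - (y i)%:MP) * A (i, enum_val a) (enum_val b).
pose M := (c0 ^+ k0)%:M - B.
pose x : 'cV[{mpoly K[n]}]_N := \col_a 'X_[mon (enum_val a)].
have Mx : map_mx F M *m x = 0.
  apply/colP => a; rewrite !mxE.
  transitivity (F c0 ^+ k0 * 'X_[mon (enum_val a)]
    - \sum_b F (B a b) * 'X_[mon (enum_val b)]).
    rewrite -[F c0 ^+ k0]rmorphXn.
    under eq_bigr => b _ do rewrite !mxE rmorphB mulrBl.
    rewrite sumrB; congr (_ - _); last by apply: eq_bigr => b _; rewrite !mxE.
    rewrite (bigD1 a) //= eqxx mulr1n big1 ?addr0 // => b /negbTE ba.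
    by rewrite eq_sym ba mulr0n rmorph0 mul0r.
  apply/eqP; rewrite subr_eq0; apply/eqP.
  rewrite -{1}['X_[mon (enum_val a)]]mul1r e1 mulr_suml mulr_sumr.
  transitivity (\sum_(i < n) \sum_(b < N) (f i - (y i)%:MP) *
      (F (A (i, enum_val a) (enum_val b)) * 'X_[mon (enum_val b)])).
    apply: eq_bigr => i _; rewrite -mulr_sumr.
    have := AP (i, enum_val a); rewrite sumT => <- /=.
    rewrite -mulrA [RHS]mulrCA; congr (_ * _); exact: mulrCA.
  rewrite exchange_big; apply: eq_bigr => b _; rewrite mxE raddf_sum /= mulr_suml.
  apply: eq_bigr => i _.
  by rewrite rmorphM rmorphB /= mmapX mmap1U mmapC mulrA.
(* By the adjugate, [\det M] times [x] is zero after substitution, and the entry of [x] for the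
   trivial monomial is [1]; independence of [f] removes the substitution. *)
have detM : \det M = 0.
  apply: f_indep; rewrite -det_map_mx.
  pose a0 := enum_rank ([ffun=> ord0] : T).
  have : \det (map_mx F M) *: x = 0.
    by rewrite -mul_scalar_mx -mul_adj_mx -mulmxA Mx mulmx0.
  move/colP/(_ a0); rewrite !mxE enum_rankK (_ : mon _ = 0%MM) ?mpolyX0 ?mulr1 //.
  by apply/mnmP => i; rewrite mnmE ffunE mnm0E.
have := congr1 (meval y) detM; rewrite -det_map_mx rmorph0.
have -> : map_mx (meval y) M = (c0.@[y] ^+ k0)%:M.
  apply/matrixP => a b; rewrite !mxE rmorphB rmorphMn rmorphXn /=.
  rewrite (raddf_sum (meval y)) /=.
  rewrite big1 ?subr0 // => i _.
  by rewrite rmorphM rmorphB /= mevalXU mevalC subrr mul0r.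
by move/eqP; rewrite det_scalar !expf_eq0 (negbTE nz_c0) !andbF.
Qed.

(** Modulo the fibre ideal a polynomial in the [f i] is congruent to its value at [y], so the
    relation of ['X_j] becomes an equation with constant coefficients. Its leading coefficient is a
    factor of [c0.@[y]], so [ideal_point] applies. *)
Lemma fibre_point y : c0.@[y] != 0 -> exists x, forall i, (f i).@[x] = y i.
Proof.
move=> nz_c0.
have idI : is_ideal (fibre_ideal y).
  split=> [|_ _ [h ->] [h' ->]|a _ [h ->]].
  - by exists (fun=> 0); rewrite big1 // => i _; rewrite mul0r.
  - exists (fun i => h i + h' i); rewrite -big_split; apply: eq_bigr => i _.
    by rewrite mulrDl.
  - exists (fun i => a * h i); rewrite mulr_sumr; apply: eq_bigr => i _.
    by rewrite mulrA.
have gen i : fibre_ideal y (f i - (y i)%:MP).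
  exists (fun j => (j == i)%:R); rewrite (bigD1 i) //= eqxx mul1r.
  by rewrite big1 ?addr0 // => j /negbTE ->; rewrite mul0r.
have modF g : fibre_ideal y (F g - g.@[y]%:MP).
  case: idI => I0 ID IM; elim/mpoly_ring_ind: g => [c|i|p q Jp Jq|p q Jp Jq].
  - by rewrite mmapC mevalC subrr.
  - by rewrite mmapX mmap1U mevalXU; apply: gen.
  - by rewrite rmorphD /= mevalD mpolyCD opprD addrACA; apply: ID.
  - rewrite rmorphM /= mevalM mpolyCM.
    have -> : F p * F q - p.@[y]%:MP * q.@[y]%:MP =
      F q * (F p - p.@[y]%:MP) + p.@[y]%:MP * (F q - q.@[y]%:MP) by ring.
    by apply: ID; apply: IM.
have [|x xP] := ideal_point idI (fibre_ideal_proper nz_c0).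
- move=> j; exists (map_poly (meval y) (P j)).
    apply: contraNneq nz_c0 => /polyP/(_ D.+1).
    rewrite coef0 coef_map /c0 (bigD1 j) //= mevalM lead_coefE szP /= => ->.
    by rewrite mul0r.
  case: (idI) => I0 ID IM.
  have -> : (map_poly (mpolyC n (R:=K)) (map_poly (meval y) (P j))).['X_j] =
    \sum_(l < D.+2) (-1 * 'X_j ^+ l) * (F (P j)`_l - (((P j)`_l).@[y])%:MP).
    rewrite -[LHS]subr0.
    apply: etrans (congr1 (fun z => _ - z) (esym (P0 j))) _.
    rewrite (@horner_coef_wide _ D.+2 (pcomp _)); last first.
      by rewrite -(szP j) size_poly.
    rewrite (@horner_coef_wide _ D.+2); last first.
      by rewrite (leq_trans (size_poly _ _)) // -(szP j) size_poly.
    rewrite -sumrB; apply: eq_bigr => l _; rewrite !coef_map /=; ring.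
  elim/big_ind: _ => // l _; exact: IM.
- exists x => i; apply/eqP; rewrite -subr_eq0.
  by rewrite -(mevalC x (y i)) -mevalB xP.
Qed.

End Lift.

(** Where [h] vanishes on the fibre over [y], a minimal relation [Q] for [h] reduces to the
    vanishing of its constant coefficient at [y]. This coefficient is a nonzero polynomial, and is
    therefore put into [c] as a factor. *)
Lemma square_image_open (h : {mpoly K[n]}) : h != 0 ->
  exists2 c : {mpoly K[n]}, c != 0 & forall y, c.@[y] != 0 ->
    exists2 x, (forall i, (f i).@[x] = y i) & h.@[x] != 0.
Proof.
move=> nz_h; have [D [P PP]] := relations_of_equal_size.
have szP j : size (P j) = D.+2 by case: (PP j).
have P0 j : (pcomp (P j)).['X_j] = 0 by case: (PP j).
have [Q [szQ Qh minQ]] := minimal_relation f_indep (square_algebraic h).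
exists (\prod_j lead_coef (P j) * Q`_0).
  rewrite mulf_neq0 //.
    apply/prodf_neq0 => j _; rewrite lead_coef_eq0 -size_poly_eq0 szP //.
  apply/eqP => Q00; pose Q' := Q %/ 'X.
  have eQ : Q = \poly_(i < (size Q).-1) Q`_i.+1 * 'X.
    apply/polyP => i; rewrite coefMX coef_poly; case: i => //= i.
    by case: ltnP => // le_i; rewrite nth_default //; move: szQ le_i; lia.
  set R := \poly_(_ < _) _ in eQ; move: Qh; rewrite eQ rmorphM /= map_polyX.
  rewrite hornerMX => /eqP; rewrite mulf_eq0 (negbTE nz_h) orbF.
  apply/negP/minQ; last by apply: leq_ltn_trans (size_poly _ _) _; case: size szQ.
  by apply: contraTneq szQ => R0; rewrite eQ R0 mul0r size_poly0.
move=> y; rewrite mevalM mulf_eq0 negb_or => /andP [nz_c nz_Q].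
have [x xP] := fibre_point szP P0 nz_c.
exists x => //; apply: contraNneq nz_Q => hx.
have := congr1 (meval x) Qh; rewrite rmorph0.
rewrite (horner_coef (pcomp Q)) raddf_sum /=.
have [s szs] : exists s, size (pcomp Q) = s.+1.
  exists (size (pcomp Q)).-1; rewrite prednK // lt0n size_poly_eq0.
  apply: contraTneq szQ => Q0.
  rewrite -leqNgt; apply/leq_sizeP => -[//|i] _; apply: f_indep.
  by have /polyP/(_ i.+1) := Q0; rewrite coef_map coef0.
rewrite szs big_ord_recl /= big1 => [|i _]; last first.
  by rewrite mevalM rmorphXn /= hx expr0n mulr0.
rewrite addr0 expr0 mulr1 coef_map /= meval_mcomp => e0.
by apply/eqP; rewrite -[RHS]e0; apply: meval_eq => i; rewrite xP.
Qed.

End ImageOpen.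

(** The rows of [C] complete the Jacobian to an invertible matrix; as linear forms they have
    Jacobian [C], which reduces to the square case. The resulting open condition also involves the
    values of these forms, which are fixed by a point [w] where [c] does not vanish. *)
Lemma dominant_image_open (K : numClosedFieldType) m n
    (q : 'I_m -> {mpoly K[n]}) p (h : {mpoly K[n]}) :
  row_free (jacobian q p) -> h != 0 ->
  exists2 c : {mpoly K[m]}, c != 0 & forall y, c.@[y] != 0 ->
    exists2 x, (forall i, (q i).@[x] = y i) & h.@[x] != 0.
Proof.
move=> free_q nz_h.
have [k En] : exists k, n = (m + k)%N.
  exists (n - m)%N; rewrite subnKC // -(eqP free_q) rank_leq_col //.
subst n; pose A := jacobian q p; pose R := row_ebase A.
pose C := dsubmx R.
have unitAC : col_mx A C \in unitmx.
  have eA : A = col_ebase A *m usubmx R.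
    rewrite -{1}(mulmx_ebase A) -mulmxA; congr (_ *m _).
    rewrite (eqP free_q) -/R -[in LHS](vsubmxK R).
    rewrite (_ : pid_mx m = row_mx 1%:M 0 :> 'M_(m, m + k)) ?mul_row_col.
      by rewrite mul1mx mul0mx addr0.
    apply/matrixP => i j; rewrite !mxE ltn_ord andbT.
    by case: splitP => j' ->; rewrite !mxE // ltn_eqF // ltn_addr.
  have -> : col_mx A C = block_mx (col_ebase A) 0 0 1%:M *m R.
    rewrite -[R in RHS]vsubmxK mul_block_col !mul0mx addr0 add0r mul1mx.
    by rewrite -eA.
  rewrite unitmx_mul row_ebase_unit andbT unitmxE det_ublock det1 mulr1.
  by rewrite -unitmxE col_ebase_unit.
pose f (i : 'I_(m + k)) := match split i with
  | inl a => q a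
  | inr b => \sum_j C b j *: 'X_j
  end.
have jacf : jacobian f p = col_mx A C.
  apply/matrixP => i j; rewrite !mxE /f; case: splitP => a _.
    by rewrite !mxE.
  rewrite (raddf_sum (mderiv j)) (raddf_sum (meval p)) /= (bigD1 j) //=.
  rewrite big1 => [|l /negbTE lj].
    by rewrite mderivZ mderivX mnm1E eqxx submm mpolyX0 scale1r mevalZ meval1
       mulr1 addr0.
  by rewrite mderivZ mderivX mnm1E lj scale0r scaler0 meval0.
have f_indep : alg_indep f by apply: (@alg_indep_of_jacobian _ _ _ p); rewrite jacf.
have [c nz_c cP] := square_image_open f_indep nz_h.
have [w cw] := mpoly_neq0_point nz_c.
pose sub (i : 'I_(m + k)) : {mpoly K[m]} := match split i with
  | inl a => 'X_a
  | inr b => (w (rshift m b))%:MP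
  end.
pose wl y (i : 'I_(m + k)) := match split i with
  | inl a => y a
  | inr b => w (rshift m b)
  end.
have subE y : (mcomp sub c).@[y] = c.@[wl y].
  rewrite meval_mcomp; apply: meval_eq => i; rewrite /sub /wl.
  by case: split => a; rewrite ?mevalXU ?mevalC.
exists (mcomp sub c).
  apply: contraNneq cw => c0.
  have := subE (fun a => w (lshift k a)); rewrite c0 meval0 => /eqP.
  rewrite eq_sym (_ : c.@[wl _] = c.@[w]) //; apply: meval_eq => i.
  by rewrite /wl -[in RHS](splitK i) /unsplit; case: split.
move=> y; rewrite subE => /cP [x xP hx]; exists x => // a.
have := xP (lshift k a); rewrite /f /wl.
by rewrite (unsplitK (inl a : 'I_m + 'I_k)).
Qed.

(** * Generic complete intersections *)

Section HomogeneousCombinations.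

Variables (K : comNzRingType) (n : nat).
Implicit Types p g : {mpoly K[n]}.

Lemma msize_homog j p : p \is j.-homog -> (msize p <= j.+1)%N.
Proof.
move=> hp; rewrite msizeE; apply/bigmax_leqP_seq => m m_p _.
by have := dhomog_mf hp m_p => /= ->.
Qed.

Lemma pihomogM e j c p : p \is e.-homog ->
  pihomog mdeg j (c * p) =
  if (e <= j)%N then pihomog mdeg (j - e) c * p else 0.
Proof.
move=> hp; elim/mpolyind: c => [|a m c _ _ IHc].
  by rewrite mul0r !linear0 mul0r if_same.
rewrite mulrDl linearD /= IHc.
have -> : pihomog mdeg j (a *: 'X_[m] * p) =
    if (e <= j)%N then pihomog mdeg (j - e) (a *: 'X_[m]) * p else 0.
  rewrite -scalerAl linearZ /= linearZ /= pihomogX.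
  have hXp : 'X_[m] * p \is (mdeg m + e).-homog.
    by apply: dhomogM => //; rewrite dhomogX.
  have [em|em] := eqVneq (mdeg m + e)%N j.
    by rewrite -em leq_addl addnK eqxx pihomog_dE // scalerAl.
  rewrite (pihomog_ne0 em hXp) scaler0; case: leqP => // le_ej.
  rewrite (_ : (mdeg m == j - e)%N = false) ?scaler0 ?mul0r //.
  by apply: contra_neqF em => /eqP ->; rewrite subnK.
by case: leqP => _; rewrite ?addr0 // linearD mulrDl.
Qed.

Variables (k : nat) (e : 'I_k -> nat) (H : 'I_k -> {mpoly K[n]}).
Hypothesis H_homog : forall i, H i \is (e i).-homog.

(** The second clause corrects the truncated subtraction: for [j < e l] the degree [j - e l] is [0]
    and would admit constants. *)
Definition hspan j p := exists c : 'I_k -> {mpoly K[n]},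
  [/\ forall l, c l \is (j - e l).-homog, forall l, (j < e l)%N -> c l = 0
     & p = \sum_l c l * H l].

Lemma hspan_pihomog j (c : 'I_k -> {mpoly K[n]}) :
  hspan j (pihomog mdeg j (\sum_l c l * H l)).
Proof.
exists (fun l => if (e l <= j)%N then pihomog mdeg (j - e l) (c l) else 0).
split=> [l|l|]; first by case: ifP => _; rewrite ?pihomogP ?rpred0.
  by rewrite ltnNge => /negbTE ->.
rewrite linear_sum; apply: eq_bigr => l _; rewrite /= (pihomogM _ _ (H_homog l)).
by case: ifP => _; rewrite ?mul0r.
Qed.

Lemma hspan0 j : hspan j 0.
Proof.
exists (fun=> 0); split=> // [l|]; first exact: rpred0.
by rewrite big1 // => l _; rewrite mul0r.
Qed.

Lemma hspanD j p q : hspan j p -> hspan j q -> hspan j (p + q).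
Proof.
case=> [c [hc c0 ->]] [c' [hc' c'0 ->]]; exists (fun l => c l + c' l); split.
- by move=> l; apply: rpredD.
- by move=> l lt_j; rewrite c0 // c'0 // addr0.
- by rewrite -big_split; apply: eq_bigr => l _; rewrite mulrDl.
Qed.

Lemma hspanZ j a p : hspan j p -> hspan j (a *: p).
Proof.
case=> [c [hc c0 ->]]; exists (fun l => a *: c l); split.
- by move=> l; apply: dhomogZ.
- by move=> l lt_j; rewrite c0 // scaler0.
- by rewrite scaler_sumr; apply: eq_bigr => l _; rewrite scalerAl.
Qed.

Lemma hspan_gen j l c :
  (e l <= j)%N -> c \is (j - e l).-homog -> hspan j (c * H l).
Proof.
move=> le_j hc; exists (fun i => if i == l then c else 0); split=> [i|i|].
- by case: eqP => [->|_]; rewrite ?hc ?rpred0.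
- by case: eqP => [->|//]; rewrite ltnNge le_j.
- rewrite (bigD1 l) //= eqxx big1 ?addr0 // => i /negbTE ->.
  by rewrite mul0r.
Qed.

Lemma hspan_homogM j i p q :
  hspan j p -> q \is i.-homog -> hspan (j + i) (p * q).
Proof.
case=> [c [hc c0 ->]] hq; rewrite mulr_suml.
elim/big_ind: _ => [|x y|l _]; [exact: hspan0|exact: hspanD|].
rewrite mulrAC; have [le_j|lt_j] := leqP (e l) j.
  apply: hspan_gen; first by rewrite (leq_trans le_j) ?leq_addr.
  by rewrite addnC -addnBA // addnC; apply: dhomogM.
by rewrite c0 // !mul0r; apply: hspan0.
Qed.

End HomogeneousCombinations.

Lemma mnm_le_mdeg n J (m : 'X_{1..n}) : (J <= mdeg m)%N ->
  exists2 m1 : 'X_{1..n}, (m1 <= m)%MM & mdeg m1 = J.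
Proof.
elim: (mdeg m - J)%N {-2}m (erefl (mdeg m - J)%N) => [|k IHk] {}m em le_J.
  by exists m; rewrite ?lepm_refl //; move: em le_J; lia.
have [i m_i] : exists i, m i != 0%N.
  apply/existsP; rewrite -negb_forall; apply/negP => /forallP m0.
  by have := mdegE m; rewrite big1 => [|i _]; [lia|apply/eqP].
have le_i : (U_(i) <= m)%MM by rewrite lep1mP.
have := mdegD (m - U_(i))%MM U_(i); rewrite submK // mdeg1 addn1 => em2.
have [||m1 le1 dm1] := IHk (m - U_(i))%MM; try lia.
by exists m1 => //; apply: lepm_trans le1 (lem_subr _ _).
Qed.

(** * From powers of the variables to other forms of the same degrees *)

Section PowerBasis.

Variables (K : fieldType) (n : nat) (e : 'I_n -> nat) (H : 'I_n -> {mpoly K[n]}).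
Hypothesis e_gt0 : forall i, (0 < e i)%N.
Hypothesis H_homog : forall i, H i \is (e i).-homog.

(* [Psi] turns [x_i ^ e_i] into [H_i] and is linear over the subring they
   generate.  When it is bijective, the polynomial ring is free over [K[H]] with
   the monomials of the box [m i < e i] as a basis, as it is over
   [K[x_i ^ e_i]]. *)
Definition psi_mon (m : 'X_{1..n}) : {mpoly K[n]} :=
  (\prod_i H i ^+ (m i %/ e i)) * 'X_[[multinom (m i %% e i)%N | i < n]].

Definition Psi (g : {mpoly K[n]}) : {mpoly K[n]} :=
  \sum_(m <- msupp g) g@_m *: psi_mon m.

Lemma PsiE k g : (msize g <= k)%N ->
  Psi g = \sum_(m : 'X_{1..n < k}) g@_m *: psi_mon m.
Proof.
move=> le_gk; rewrite /Psi (big_mksub 'X_{1..n < k}) ?msupp_uniq //=; first last.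
  by move=> x /msize_mdeg_lt /leq_trans; apply.
by rewrite big_rmcond //= => i /memN_msupp_eq0 ->; rewrite scale0r.
Qed.

Lemma Psi_is_linear : linear Psi.
Proof.
move=> c g h; pose k := maxn (msize (c *: g + h)) (maxn (msize g) (msize h)).
rewrite !(@PsiE k) ?leq_max ?leqnn ?orbT //.
rewrite scaler_sumr -big_split; apply: eq_bigr => m _ /=.
by rewrite mcoeffD mcoeffZ scalerDl scalerA.
Qed.

HB.instance Definition _ := GRing.isLinear.Build K {mpoly K[n]} {mpoly K[n]} _
  Psi Psi_is_linear.

Lemma PsiX m : Psi 'X_[m] = psi_mon m.
Proof. by rewrite /Psi msuppX big_seq1 mcoeffX eqxx scale1r. Qed.

Lemma psi_monD i m : psi_mon (U_(i) *+ e i + m) = H i * psi_mon m.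
Proof.
rewrite /psi_mon mulrA; congr (_ * 'X_[_]); last first.
  apply/mnmP => j; rewrite !mnmE mulmnE mnm1E.
  by case: eqP => [->|_]; rewrite ?mul1n ?mul0n // modnDl.
rewrite (bigD1 i) //= [in RHS](bigD1 i) //= mulrA mnmDE mulmnE mnm1E eqxx mul1n.
rewrite divnDl // divnn e_gt0 exprD expr1; congr (_ * _).
apply: eq_bigr => j /negbTE ji.
by rewrite mnmDE mulmnE mnm1E eq_sym ji mul0n add0n.
Qed.

Lemma psi_mon_box (m : 'X_{1..n}) : (forall i, m i < e i)%N -> psi_mon m = 'X_[m].
Proof.
move=> ltm; rewrite /psi_mon big1 ?mul1r => [|i _]; last first.
  by rewrite divn_small // expr0.
by congr 'X_[_]; apply/mnmP => i; rewrite mnmE modn_small.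
Qed.

Lemma PsiM i g : Psi ('X_i ^+ e i * g) = H i * Psi g.
Proof.
rewrite [g in LHS]mpolyE mulr_sumr linear_sum mulr_sumr; apply: eq_bigr => m _.
by rewrite -!scalerAr linearZ /= -psi_monD -PsiX mpolyXD mpolyXn.
Qed.

Lemma psi_mon_homog m : psi_mon m \is (mdeg m).-homog.
Proof.
have -> : mdeg m = (\sum_i (e i * (m i %/ e i)) +
    mdeg [multinom (m i %% e i)%N | i < n])%N.
  rewrite !mdegE -big_split /=; apply: eq_bigr => i _.
  by rewrite mnmE mulnC -divn_eq.
apply: dhomogM; last by rewrite dhomogX.
elim/big_ind2: _ => [|x a y b|i _]; first exact: dhomog1.
  exact: dhomogM.
exact: dhomogMn.
Qed.

Lemma Psi_pihomog j g : Psi (pihomog mdeg j g) = pihomog mdeg j (Psi g).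
Proof.
elim/mpolyind: g => [|c m g _ _ IHg]; first by rewrite !linear0.
rewrite !linearD !linearZ /= IHg PsiX pihomogX; congr (_ *: _ + _).
case: eqP => [<-|/eqP ne_j]; first by rewrite PsiX pihomog_dE ?psi_mon_homog.
by rewrite linear0 (pihomog_ne0 ne_j) ?psi_mon_homog.
Qed.

(** [Psi] preserves degrees, so it acts on the finite-dimensional space of polynomials of degree at
    most [J]; its bijectivity there is an open condition on the coefficients of [H]. *)
Definition psi_mx J : 'M[K]_#|{: 'X_{1..n < J.+1}}| :=
  \matrix_(a, b)
    (psi_mon (enum_val a : 'X_{1..n < _}))@_(enum_val b : 'X_{1..n < _}).

Definition bcoef J (g : {mpoly K[n]}) : 'rV[K]_#|{: 'X_{1..n < J.+1}}| :=
  \row_a g@_(enum_val a : 'X_{1..n < J.+1}).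

Lemma psi_mx_mul J g : (msize g <= J.+1)%N ->
  bcoef J g *m psi_mx J = bcoef J (Psi g).
Proof.
move=> le_g; apply/rowP => b; rewrite !mxE (PsiE le_g) raddf_sum /=.
rewrite [RHS](reindex (@enum_val _ predT)) /=; last first.
  exact/onW_bij/enum_val_bij.
by apply: eq_bigr => a _; rewrite !mxE mcoeffZ.
Qed.

Lemma msize_Psi J g : (msize g <= J.+1)%N -> (msize (Psi g) <= J.+1)%N.
Proof.
move=> le_g; rewrite (PsiE le_g); apply: leq_trans (msize_sum _ _ _) _.
apply/bigmax_leqP => m _; apply: leq_trans (msizeZ_le _ _) _.
have [->|nz] := eqVneq (psi_mon m) 0; first by rewrite msize0.
rewrite -(mlead_deg nz).
by rewrite (dhomog_mf (psi_mon_homog m) (mlead_supp nz)) bmdeg.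
Qed.

Lemma mcoeff_bounded_eq J (g h : {mpoly K[n]}) :
  (msize g <= J.+1)%N -> (msize h <= J.+1)%N ->
  (forall m : 'X_{1..n < J.+1}, g@_m = h@_m) -> g = h.
Proof.
move=> le_g le_h eq_gh; rewrite (mpolywE le_g) (mpolywE le_h).
by apply: eq_bigr => m _; rewrite eq_gh.
Qed.

Lemma Psi_inj J g : psi_mx J \in unitmx -> (msize g <= J.+1)%N ->
  Psi g = 0 -> g = 0.
Proof.
move=> unitJ le_g Psig.
have := psi_mx_mul le_g; rewrite Psig => e0.
have {}e0 : bcoef J g = 0.
  rewrite -[LHS](mulmxK unitJ) e0 (_ : bcoef J 0 = 0) ?mul0mx //.
  by apply/rowP => b; rewrite !mxE mcoeff0.
apply: (mcoeff_bounded_eq le_g); rewrite ?msize0 // => m.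
by have /rowP/(_ (enum_rank m)) := e0; rewrite !mxE enum_rankK mcoeff0.
Qed.

Lemma Psi_surj J g : psi_mx J \in unitmx -> (msize g <= J.+1)%N ->
  exists2 g', (msize g' <= J.+1)%N & Psi g' = g.
Proof.
move=> unitJ le_g.
pose u := bcoef J g *m invmx (psi_mx J).
pose E (m : 'X_{1..n}) := u 0 (enum_rank (insubd (bm0 : 'X_{1..n < J.+1}) m)).
pose g' := \sum_(m : 'X_{1..n < J.+1}) E m *: 'X_[m].
have le_g' : (msize g' <= J.+1)%N.
  apply: leq_trans (msize_sum _ _ _) _; apply/bigmax_leqP => m _.
  by apply: leq_trans (msizeZ_le _ _) _; rewrite msizeX bmdeg.
exists g' => //; apply: (mcoeff_bounded_eq (msize_Psi le_g') le_g) => m.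
have : bcoef J (Psi g') = bcoef J g.
  rewrite -psi_mx_mul // (_ : bcoef J g' = u) ?mulmxKV //.
  apply/rowP => a; rewrite mxE mcoeff_mpoly ?bmdeg // /E.
  by rewrite valKd enum_valK.
by move/rowP/(_ (enum_rank m)); rewrite !mxE enum_rankK.
Qed.

Lemma Psi_surj_homog J j g : psi_mx J \in unitmx -> (j <= J)%N ->
  g \is j.-homog -> exists2 g', g' \is j.-homog & Psi g' = g.
Proof.
move=> unitJ le_j hg.
have [|g' _ eg'] := Psi_surj unitJ (_ : msize g <= J.+1)%N.
  by apply: leq_trans (msize_homog hg) _.
exists (pihomog mdeg j g'); first exact: pihomogP.
by rewrite Psi_pihomog eg' pihomog_dE.
Qed.

Definition box j : {set 'X_{1..n < j.+1}} :=
  [set m : 'X_{1..n < j.+1} | (mdeg m == j) && [forall i, m i < e i]%N].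

(** A normal form modulo [H]: [Psi] fixes the box monomials and sends every other one to a multiple
    of some [H l]. *)
Lemma Psi_box_part j g : g \is j.-homog ->
  exists2 p, hspan e H j p & Psi g = \sum_(m in box j) g@_m *: 'X_[m] + p.
Proof.
move=> hg; rewrite (PsiE (msize_homog hg)) (bigID (mem (box j))) /=.
exists (\sum_(m | m \notin box j) g@_m *: psi_mon m); last first.
  congr (_ + _); apply: eq_bigr => m; rewrite inE => /andP [_ /forallP ltm].
  by rewrite psi_mon_box.
elim/big_ind: _ => [|x y|m m_box]; [exact: hspan0|exact: hspanD|].
have [|/eqP g_m] := eqVneq (g@_m) 0.
  by move=> ->; rewrite scale0r; apply: hspan0.
apply: hspanZ; have degm : mdeg m = j.
  by apply: (dhomog_mf hg); rewrite mcoeff_msupp; apply/eqP.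
move: m_box; rewrite inE degm eqxx /= negb_forall => /existsP [l].
rewrite -leqNgt => le_l.
have le_m : (U_(l) *+ e l <= m)%MM.
  apply/mnm_lepP => i; rewrite mulmnE mnm1E.
  by case: eqP => [<-|_]; rewrite ?mul1n ?mul0n.
have em : (U_(l) *+ e l + (m - U_(l) *+ e l))%MM = m by rewrite addmC submK.
have dm : (e l + mdeg (m - U_(l) *+ e l))%N = j.
  by rewrite -[in RHS]degm -[in RHS]em mdegD mdegMn mdeg1 mul1n.
rewrite -em psi_monD mulrC; apply: hspan_gen.
  by rewrite -dm leq_addr.
have -> : (j - e l = mdeg (m - U_(l) *+ e l))%N.
  by rewrite -[X in (X - _)%N]dm addKn.
exact: psi_mon_homog.
Qed.

(** Lifting the cofactors turns [H l] into ['X_l ^+ e l]: the preimage lies in the ideal of these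
    powers, where no box monomial occurs. *)
Lemma hspan_Psi J j p : psi_mx J \in unitmx -> (j <= J)%N -> hspan e H j p ->
  exists w, [/\ (msize w <= j.+1)%N, Psi w = p
    & forall m : 'X_{1..n}, (forall i, m i < e i)%N -> w@_m = 0].
Proof.
move=> unitJ le_j [c [hc c0 ->]].
have /fin_all_exists [c' c'P] (l : 'I_n) : exists c' : {mpoly K[n]},
    [/\ c' \is (j - e l).-homog, Psi c' = c l & (j < e l)%N -> c' = 0].
  have [le_l|lt_l] := leqP (e l) j; last first.
    by exists 0; split; rewrite ?rpred0 // linear0 c0.
  have [|c' hc' ec'] := Psi_surj_homog unitJ _ (hc l).
    exact: leq_trans (leq_subr _ _) le_j.
  by exists c'; split=> //; rewrite ltnNge le_l.
exists (\sum_l 'X_l ^+ e l * c' l); split.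
- apply: leq_trans (msize_sum _ _ _) _; apply/bigmax_leqP => l _.
  have [hc' _ c'0] := c'P l; have [le_l|/c'0 ->] := leqP (e l) j; last first.
    by rewrite mulr0 msize0.
  apply: msize_homog; rewrite -(subnKC le_l); apply: dhomogM => //.
  by rewrite mpolyXn dhomogX /= mdegMn mdeg1 mul1n.
- rewrite linear_sum; apply: eq_bigr => l _; rewrite /= PsiM mulrC.
  by case: (c'P l) => _ -> _.
- move=> m ltm; rewrite raddf_sum big1 //= => l _; rewrite mpolyXn mulrC.
  apply: memN_msupp_eq0; apply/negP => /msuppM_le /allpairsP [[m1 m2] /=].
  rewrite msuppX inE => -[_ /eqP -> em]; have := ltm l.
  by rewrite em mnmDE mulmnE mnm1E eqxx mul1n ltnNge leq_addl.
Qed.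

Lemma not_hspan_box J j (m : 'X_{1..n}) : psi_mx J \in unitmx -> (j <= J)%N ->
  mdeg m = j -> (forall i, m i < e i)%N -> ~ hspan e H j 'X_[m].
Proof.
move=> unitJ le_j dm ltm /(hspan_Psi unitJ le_j) [w [szw ew w0]].
have le_w : (msize w <= J.+1)%N by apply: leq_trans szw _.
have : 'X_[m] - w = 0.
  apply: (Psi_inj unitJ); last by rewrite linearB /= PsiX ew psi_mon_box ?subrr.
  apply: leq_trans (msizeD_le _ _) _.
  by rewrite geq_max msizeN le_w msizeX dm ltnS le_j.
move/(congr1 (mcoeff m)); rewrite mcoeffB w0 // mcoeffX eqxx subr0 mcoeff0.
by move/eqP; rewrite oner_eq0.
Qed.

(* Modulo the [H_l], a multiple of [G] in degree [d] is a combination of the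
   products of [G] with the box monomials of degree [d - b]. *)
Lemma card_box_leq J d b (G : {mpoly K[n]}) : psi_mx J \in unitmx ->
  (d <= J)%N -> (b <= d)%N -> G \is b.-homog ->
  (forall p, p \is d.-homog ->
     exists c0, exists c : 'I_n -> {mpoly K[n]}, p = c0 * G + \sum_l c l * H l) ->
  (#|box d| <= #|box (d - b)|)%N.
Proof.
move=> unitJ le_d le_b hG span.
have hGm (m : 'X_{1..n < (d - b).+1}) :
    m \in box (d - b) -> 'X_[m] * G \is d.-homog.
  rewrite inE => /andP [/eqP dm _].
  have : 'X_[m] * G \is (d - b + b).-homog.
    by apply: dhomogM; rewrite // dhomogX /= dm.
  by rewrite subnK.
have /fin_all_exists [g gP] (b0 : 'I_#|box (d - b)|) : exists g : {mpoly K[n]},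
    g \is d.-homog /\ Psi g = 'X_[enum_val b0 : 'X_{1..n < _}] * G.
  have [g hg eg] := Psi_surj_homog unitJ le_d (hGm _ (enum_valP b0)).
  by exists g.
(* [g b0] is the preimage of [G] times a box monomial, and [Theta] keeps its box coordinates. These
   products span modulo the [H l], so each unit vector is a combination of rows, and there are at
   least as many rows as columns. *)
pose Theta := \matrix_(b0 < #|box (d - b)|, a < #|box d|)
  (g b0)@_(enum_val a : 'X_{1..n < _}).
have /fin_all_exists [u uP] (a : 'I_#|box d|) :
    exists u : 'rV[K]_#|box (d - b)|, u *m Theta = delta_mx 0 a.
  have := enum_valP a; set m := enum_val a; rewrite inE => /andP [/eqP dm ltm].
  have {}ltm i : (m i < e i)%N by move/forallP: ltm.
  have hm : ('X_[m] : {mpoly K[n]}) \is d.-homog by rewrite dhomogX /= dm.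
  have [c0 [c em]] := span _ hm.
  have {em} := congr1 (pihomog mdeg d) em.
  rewrite pihomog_dE // linearD /= (pihomogM _ _ hG) le_b.
  set q := pihomog _ _ (\sum_l _) => em.
  have hq : hspan e H d q by apply: hspan_pihomog.
  have [c1 hc1 ec1] := Psi_surj_homog unitJ (leq_trans (leq_subr b d) le_d)
    (pihomogP mdeg (d - b) c0).
  have [p hp ep] := Psi_box_part hc1.
  move: em; rewrite -ec1 ep mulrDl -addrA.
  set q' := p * G + q; have hq' : hspan e H d q'.
    apply: hspanD => //; rewrite -(subnK le_b).
    exact: hspan_homogM.
  have [w [szw ew w0]] := hspan_Psi unitJ le_d hq'.
  pose v := \row_(b0 < #|box (d - b)|) c1@_(enum_val b0 : 'X_{1..n < _}).
  rewrite mulr_suml big_enum_val /= => em.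
  have : 'X_[m] - (\sum_b0 v 0 b0 *: g b0 + w) = 0.
    apply: (Psi_inj unitJ); last first.
      rewrite linearB linearD linear_sum /= PsiX psi_mon_box // em ew.
      apply/eqP; rewrite subr_eq0; apply/eqP; congr (_ + _).
      apply: eq_bigr => b0 _; rewrite linearZ /= mxE; case: (gP b0) => _ ->.
      by rewrite scalerAl.
    have bnd x : (msize x <= d.+1)%N -> (msize x <= J.+1)%N.
      by move/leq_trans; apply.
    rewrite bnd //; apply: leq_trans (msizeD_le _ _) _; rewrite geq_max.
    rewrite msizeX dm leqnn msizeN; apply: leq_trans (msizeD_le _ _) _.
    rewrite geq_max szw andbT; apply: leq_trans (msize_sum _ _ _) _.
    apply/bigmax_leqP => b0 _; apply: leq_trans (msizeZ_le _ _) _.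
    by case: (gP b0) => /msize_homog.
  move=> e0; exists v; apply/rowP => a'; rewrite !mxE.
  have := congr1 (mcoeff (enum_val a' : 'X_{1..n < d.+1})) e0.
  rewrite mcoeff0 mcoeffB mcoeffD mcoeffX => /eqP.
  have := enum_valP a'; rewrite inE => /andP [_ /forallP ltm'].
  rewrite w0 // addr0 subr_eq0 => /eqP; rewrite eqxx andTb.
  rewrite (_ : (m == _ :> 'X_{1..n}) = (a' == a)); last first.
    by rewrite -bmeqP (inj_eq enum_val_inj) eq_sym.
  move=> ->; rewrite raddf_sum; apply: eq_bigr => b0 _.
  by rewrite /= mcoeffZ !mxE.
have : (\matrix_a u a) *m Theta = 1%:M.
  by apply/row_matrixP => a; rewrite row_mul rowK uP row1.
exact: mulmx1_min.
Qed.

(** [J] exceeds the degree of every box monomial, so all forms of degree [J], and then of any higher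
    degree, are combinations of the [H l]. Their cofactors have smaller degree, and induction
    applies. *)
Lemma Psi_surj_all J : psi_mx J \in unitmx ->
  (\sum_i (e i).-1 < J)%N ->
  forall j g, g \is j.-homog -> exists2 g', g' \is j.-homog & Psi g' = g.
Proof.
move=> unitJ ltJ; elim/ltn_ind => j IHj g hg.
have [le_j|lt_j] := leqP j J; first exact: Psi_surj_homog unitJ le_j hg.
suff hs : hspan e H j g.
  case: hs => c [hc c0 ->].
  have /fin_all_exists [c' c'P] (l : 'I_n) : exists c' : {mpoly K[n]},
      [/\ c' \is (j - e l).-homog, Psi c' = c l & (j < e l)%N -> c' = 0].
    have [le_l|lt_l] := leqP (e l) j; last first.
      by exists 0; split; rewrite ?rpred0 // linear0 c0.
    have [|c' hc' ec'] := IHj _ _ _ (hc l).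
      by rewrite ltn_subrL e_gt0 (leq_ltn_trans _ lt_j).
    by exists c'; split=> //; rewrite ltnNge le_l.
  exists (\sum_l 'X_l ^+ e l * c' l); last first.
    rewrite linear_sum; apply: eq_bigr => l _; rewrite /= PsiM mulrC.
    by case: (c'P l) => _ -> _.
  apply: rpred_sum => l _; case: (c'P l) => hc' _ c'0.
  have [le_l|/c'0 ->] := leqP (e l) j; last by rewrite mulr0 rpred0.
  rewrite -(subnKC le_l); apply: dhomogM => //.
  by rewrite mpolyXn dhomogX /= mdegMn mdeg1 mul1n.
rewrite [g]mpolyE big_seq.
elim/big_ind: _ => [|x y|m m_g]; [exact: hspan0|exact: hspanD|].
apply: hspanZ; have dm : mdeg m = j by apply: (dhomog_mf hg).
have [|m1 le_m dm1] := @mnm_le_mdeg _ J m; first by rewrite dm ltnW.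
rewrite -(submK le_m) addmC mpolyXD.
have hm2 : ('X_[m - m1] : {mpoly K[n]}) \is (j - J).-homog.
  rewrite dhomogX /=; have := mdegD (m - m1)%MM m1.
  by rewrite submK // dm dm1 => ->; rewrite addnK.
rewrite -(subnKC (ltnW lt_j)); apply: hspan_homogM => //.
have [|g' hg' <-] := Psi_surj_homog (g := 'X_[m1]) unitJ (leqnn J).
  by rewrite dhomogX /= dm1.
have [p hp ->] := Psi_box_part hg'.
rewrite big1 ?add0r // => a; rewrite inE => /andP [/eqP da /forallP lta].
suff : (J <= \sum_i (e i).-1)%N by rewrite leqNgt ltJ.
rewrite -da mdegE; apply: leq_sum => i _.
by have := lta i; have := e_gt0 i; lia.
Qed.

(** One determinant beyond the socle degree controls all degrees; this keeps regularity, which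
    involves polynomials of every degree, an open condition. *)
Lemma psi_mx_unit_all J : psi_mx J \in unitmx -> (\sum_i (e i).-1 < J)%N ->
  forall J', psi_mx J' \in unitmx.
Proof.
move=> unitJ ltJ J'; have surj := Psi_surj_all unitJ ltJ.
have /fin_all_exists [g gP] (a : 'I_#|{: 'X_{1..n < J'.+1}}|) :
    exists g, (msize g <= J'.+1)%N /\ Psi g = 'X_[enum_val a : 'X_{1..n < _}].
  have [|g hg eg] := surj (mdeg (enum_val a : 'X_{1..n < _}))
    'X_[enum_val a : 'X_{1..n < _}].
    by rewrite dhomogX.
  exists g; split=> //; apply: leq_trans (msize_homog hg) _; exact: bmdeg.
have : (\matrix_a bcoef J' (g a)) *m psi_mx J' = 1%:M.
  apply/row_matrixP => a; rewrite row_mul rowK; case: (gP a) => szg eg.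
  rewrite psi_mx_mul // eg; apply/rowP => b; rewrite !mxE mcoeffX.
  by rewrite -bmeqP (inj_eq enum_val_inj).
by case/mulmx1_unit.
Qed.

(** Pulled back by the bijection [Psi], the hypothesis puts ['X_(iota i) ^+ e (iota i) * g] in the
    ideal of the earlier powers. Since [iota l] and [iota i] are different variables, each monomial
    of [g] is already divisible by an earlier power, and its image has the factor [H (iota l)]. *)
Lemma regular_power_basis J r (iota : 'I_r -> 'I_n) : psi_mx J \in unitmx ->
  (\sum_i (e i).-1 < J)%N -> injective iota ->
  regular_sequence (fun i => H (iota i)).
Proof.
move=> unitJ ltJ iota_inj; have unit_all := psi_mx_unit_all unitJ ltJ.
have surj g : exists g', Psi g' = g.
  have [|g' _ eg'] := Psi_surj (J := msize g) (unit_all _) (_ : msize g <= _)%N.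
    exact: leqnSn.
  by exists g'.
have inj g : Psi g = 0 -> g = 0.
  by move=> eg; apply: (@Psi_inj (msize g)); rewrite ?unit_all ?leqnSn.
split=> [i G [c ec]|[c /(congr1 (mcoeff 0%MM))]]; last first.
  rewrite mcoeff1 eqxx raddf_sum big1 => [/eqP|i _]; first by rewrite oner_eq0.
  rewrite /= rmorphM /= (dhomog_nemf_coeff (H_homog _)) ?mulr0 //.
  by rewrite /= mdeg0 eq_sym -lt0n.
have [g eg] := surj G; have /fin_all_exists [c' c'P] (l : 'I_r) := surj (c l).
have eq0 : 'X_(iota i) ^+ e (iota i) * g
    - \sum_(l < r | (l < i)%N) 'X_(iota l) ^+ e (iota l) * c' l = 0.
  apply: inj; rewrite linearB /= PsiM (linear_sum Psi) /= eg ec.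
  apply/eqP; rewrite subr_eq0; apply/eqP; apply: eq_bigr => l _.
  by rewrite PsiM c'P mulrC.
have closed p q : in_ideal_lt (fun i => H (iota i)) i p ->
    in_ideal_lt (fun i => H (iota i)) i q ->
    in_ideal_lt (fun i => H (iota i)) i (p + q).
  move=> [a ->] [b ->]; exists (fun l => a l + b l).
  by rewrite -big_split; apply: eq_bigr => l _; rewrite mulrDl.
rewrite -eg /Psi big_seq.
elim/big_ind: _ => [|x y|m m_g]; [|exact: closed|].
  by exists (fun=> 0); rewrite big1 // => l _; rewrite mul0r.
have [l lt_l le_m] : exists2 l : 'I_r, (l < i)%N & (e (iota l) <= m (iota l))%N.
  apply: contrapT => no_l; move: m_g; rewrite mcoeff_msupp => /eqP; apply.
  have := congr1 (mcoeff (m + U_(iota i) *+ e (iota i))%MM) eq0.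
  rewrite mcoeff0 mcoeffB mulrC mpolyXn addmC mcoeffMX.
  rewrite (raddf_sum (mcoeff _)) big1 ?subr0 // => l lt_l.
  rewrite /= mpolyXn mulrC; apply: memN_msupp_eq0.
  apply/negP => /msuppM_le /allpairsP [[m1 m2] /=].
  rewrite msuppX inE => -[_ /eqP -> /mnmP/(_ (iota l))].
  rewrite !mnmDE !mulmnE !mnm1E eqxx mul1n (inj_eq iota_inj).
  rewrite (_ : (i == l) = false) ?mul0n ?add0n; last first.
    by apply: contraTF lt_l => /eqP ->; rewrite ltnn.
  by move=> em; apply: no_l; exists l; rewrite // em leq_addl.
have le_mon : (U_(iota l) *+ e (iota l) <= m)%MM.
  apply/mnm_lepP => k; rewrite mulmnE mnm1E.
  by case: eqP => [<-|_]; rewrite ?mul1n ?mul0n.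
exists (fun k => if k == l then g@_m *: psi_mon (m - U_(iota l) *+ e (iota l)) else 0).
rewrite (bigD1 l) //= eqxx big1 => [|k /andP [_ /negbTE ->]]; last by rewrite mul0r.
rewrite addr0 -scalerAl; congr (_ *: _).
by rewrite mulrC -psi_monD addmC submK.
Qed.

End PowerBasis.

Lemma psi_monX (K : fieldType) n (e : 'I_n -> nat) m :
  psi_mon e (fun l => 'X_l ^+ e l) m = 'X_[m] :> {mpoly K[n]}.
Proof.
rewrite /psi_mon (eq_bigr (fun i => 'X_[U_(i) *+ (e i * (m i %/ e i))])).
  rewrite mprodXE -mpolyXD; congr 'X_[_]; apply/mnmP => i.
  rewrite mnmDE mnm_sumE mnmE (bigD1 i) //= big1 => [|k /negbTE ki].
    by rewrite mulmnE mnm1E eqxx mul1n addn0 mulnC -divn_eq.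
  by rewrite mulmnE mnm1E ki.
by move=> i _; rewrite -exprM mpolyXn.
Qed.

(** This point shows that the determinant of [psi_mx], as a polynomial in the coefficients of the
    forms, is not zero. *)
Lemma psi_mxX (K : fieldType) n (e : 'I_n -> nat) J :
  psi_mx e (fun l => 'X_l ^+ e l : {mpoly K[n]}) J = 1%:M.
Proof.
apply/matrixP => a b; rewrite !mxE psi_monX mcoeffX.
by rewrite -bmeqP (inj_eq enum_val_inj).
Qed.

(** * The strong Lefschetz property *)

Section Lefschetz.

Variables (K : numClosedFieldType) (n : nat) (e : 'I_n -> nat).
Hypothesis e_gt0 : forall i, (0 < e i)%N.
Implicit Types (u v w : {mpoly K[n]}) (m : 'X_{1..n}).

Definition ell : {mpoly K[n]} := \sum_i 'X_i.
Definition socle_degree := (\sum_i (e i).-1)%N.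

(** In one variable, K[x]/(x^e) is the irreducible representation of sl_2 of dimension e with x as
    raising operator; this is the lowering operator, x^k |-> k (e - k) x^(k - 1), lifted to
    polynomials. *)
Definition lower i u : {mpoly K[n]} :=
  (e i).-1%:R *: u^`M(i) - 'X_i * u^`M(i)^`M(i).
Definition lowering u : {mpoly K[n]} := \sum_i lower i u.

(* Squared norm of the monomial [m] for a form making [lowering] adjoint to the
   multiplication by [ell]; it vanishes exactly outside the box [m i < e i]. *)
Definition wt m := (\prod_i ((m i)`! * (e i).-1 ^_ (m i)))%N.

Definition form u v : K := \sum_(m <- msupp u) (wt m)%:R * u@_m * (v@_m)^*.

Lemma formE k u v : (msize u <= k)%N ->
  form u v = \sum_(m : 'X_{1..n < k}) (wt m)%:R * u@_m * (v@_m)^*.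
Proof.
move=> le_k; rewrite /form (big_mksub 'X_{1..n < k}) ?msupp_uniq //=; first last.
  by move=> x /msize_mdeg_lt /leq_trans; apply.
by rewrite big_rmcond //= => i /memN_msupp_eq0 ->; rewrite mulr0 mul0r.
Qed.

Lemma formDl u u' v : form (u + u') v = form u v + form u' v.
Proof.
pose k := maxn (msize (u + u')) (maxn (msize u) (msize u')).
rewrite !(@formE k) ?leq_max ?leqnn ?orbT // -big_split; apply: eq_bigr => m _ /=.
by rewrite mcoeffD mulrDr mulrDl.
Qed.

Lemma formZl c u v : form (c *: u) v = c * form u v.
Proof.
pose k := maxn (msize (c *: u)) (msize u).
rewrite !(@formE k) ?leq_max ?leqnn ?orbT // mulr_sumr; apply: eq_bigr => m _ /=.
by rewrite mcoeffZ mulrCA !mulrA.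
Qed.

Lemma form0l v : form 0 v = 0.
Proof. by rewrite /form msupp0 big_nil. Qed.

Lemma form_sym u v : form u v = (form v u)^*.
Proof.
pose k := maxn (msize u) (msize v).
rewrite !(@formE k) ?leq_max ?leqnn ?orbT // rmorph_sum; apply: eq_bigr => m _ /=.
by rewrite !rmorphM /= conjCK conjC_nat mulrAC.
Qed.

Lemma form_suml I (r : seq I) (P : pred I) F v :
  form (\sum_(i <- r | P i) F i) v = \sum_(i <- r | P i) form (F i) v.
Proof. by elim/big_rec2: _ => [|i y x _ <-]; rewrite ?form0l ?formDl. Qed.

Lemma formXl m v : form 'X_[m] v = (wt m)%:R * (v@_m)^*.
Proof. by rewrite /form msuppX big_seq1 mcoeffX eqxx mulr1. Qed.

Lemma form_ge0 u : 0 <= form u u.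
Proof.
apply: sumr_ge0 => m _; rewrite -mulrA mulr_ge0 ?ler0n //.
exact: mul_conjC_ge0.
Qed.

(** The radical of the form consists of the polynomials without box monomials, which are those that
    vanish in the quotient by the powers; working modulo [null] avoids forming this quotient. *)
Definition null u := forall v, form v u = 0.

Lemma null_of_form0 u : form u u = 0 -> null u.
Proof.
move=> fu v; pose k := maxn (msize u) (msize v).
have : \sum_(m : 'X_{1..n < k}) (wt m)%:R * u@_m * (u@_m)^* = 0.
  by rewrite -formE // leq_maxl.
move/eqP; rewrite psumr_eq0 => [/allP zero|m _]; last first.
  by rewrite -mulrA mulr_ge0 ?ler0n ?mul_conjC_ge0.
rewrite (@formE k) ?leq_maxr // big1 // => m _.
have := zero m (mem_index_enum m); rewrite -mulrA mulf_eq0 mul_conjC_eq0.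
by case/orP => /eqP ->; rewrite ?mul0r // conjC0 mulr0.
Qed.

Lemma form_nulll u v : null u -> form u v = 0.
Proof. by move=> nu; rewrite form_sym nu conjC0. Qed.

Lemma mcoeff_mulX i u m :
  ('X_i * u)@_m = if m i == 0%N then 0 else u@_(m - U_(i)).
Proof.
rewrite mulrC; case: ifP => [/eqP m_i|/negbT m_i]; last first.
  by rewrite -lep1mP in m_i; rewrite -[in LHS](submK m_i) addmC mcoeffMX.
apply: memN_msupp_eq0; apply/negP => /msuppM_le /allpairsP [[m1 m2] /=].
rewrite msuppX inE => -[_ /eqP -> /mnmP/(_ i)].
by rewrite mnmDE mnm1E eqxx m_i addn1.
Qed.

Lemma mcoeff_lower i u m : (lower i u)@_m =
  (m i).+1%:R * ((e i).-1%:R - (m i)%:R) * u@_(m + U_(i)).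
Proof.
rewrite mcoeffB mcoeffZ mcoeff_mulX mcoeff_deriv.
case: (eqVneq (m i) 0%N) => [->|m_i]; first by rewrite !subr0 mulr1n mul1r.
have le_i : (U_(i) <= m)%MM by rewrite lep1mP.
rewrite mcoeff_deriv submK // mnmBE mnm1E eqxx mcoeff_deriv subn1 prednK ?lt0n //.
rewrite -[_ *+ (m i).+1]mulr_natr -[_ *+ (m i)]mulr_natr.
by move: ((e i).-1%:R : K) ((m i)%:R : K) ((m i).+1%:R : K) => a b c; ring.
Qed.

Lemma wtD i m : (wt (m + U_(i)) = wt m * ((m i).+1 * ((e i).-1 - m i)))%N.
Proof.
rewrite /wt (bigD1 i) //= [in RHS](bigD1 i) //= mnmDE mnm1E eqxx addn1 factS ffactnSr.
rewrite (eq_bigr (fun j => ((m j)`! * (e j).-1 ^_ (m j))%N)); last first.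
  by move=> j /negbTE ji; rewrite mnmDE mnm1E eq_sym ji addn0.
by lia.
Qed.

Lemma wt_eq0 i m : ((e i).-1 < m i)%N -> wt m = 0%N.
Proof. by move=> lt_m; rewrite /wt (bigD1 i) //= ffact_small ?muln0. Qed.

Lemma wt_gt0 m : (forall i, m i < e i)%N -> (0 < wt m)%N.
Proof.
move=> ltm; apply: prodn_gt0 => i; rewrite muln_gt0 fact_gt0 ffact_gt0.
by have := ltm i; lia.
Qed.

(** The factor by which [wt] grows from [m] to [m + U_(i)] is the coefficient in [mcoeff_lower]. *)
Lemma form_adjoint u v : form (ell * u) v = form u (lowering v).
Proof.
elim/mpolyind: u => [|c m u _ _ IHu]; first by rewrite mulr0 !form0l.
rewrite mulrDr !formDl IHu -scalerAr !formZl; congr (_ * _ + _).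
rewrite formXl /lowering raddf_sum rmorph_sum mulr_sumr mulr_suml form_suml.
apply: eq_bigr => i _ /=; rewrite -mpolyXD addmC formXl mcoeff_lower wtD.
rewrite !rmorphM rmorphB /= !conjC_nat !natrM.
(* The truncated difference in [wtD] and the ring difference in [mcoeff_lower] disagree only where
   [wt m = 0]. *)
have wtB : (wt m)%:R * ((e i).-1 - m i)%N%:R =
    (wt m)%:R * ((e i).-1%:R - (m i)%:R) :> K.
  have [le_i|lt_i] := leqP (m i) (e i).-1; first by rewrite natrB.
  by rewrite (wt_eq0 lt_i) !mul0r.
move: ((v@_(m + U_(i)))^* : K) ((m i).+1%:R : K) => a b.
transitivity ((wt m)%:R * ((e i).-1 - m i)%N%:R * (a * b)).
  by move: ((wt m)%:R : K) (((e i).-1 - m i)%N%:R : K) => x y; ring.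
rewrite wtB; move: ((wt m)%:R : K) ((e i).-1%:R : K) ((m i)%:R : K) => x y z.
by ring.
Qed.

Lemma lower_mulX i k u : lower i ('X_k * u) =
  'X_k * lower i u + (i == k)%:R * ((e i).-1%:R *: u - 2%:R *: ('X_i * u^`M(i))).
Proof.
have dX v : ('X_k * v)^`M(i) = (i == k)%:R * v + 'X_k * v^`M(i).
  rewrite mderivM mderivX mnm1E eq_sym; congr (_ + _); case: eqP => [->|_].
    by rewrite submm mpolyX0 scale1r.
  by rewrite scale0r.
rewrite /lower dX mderivD dX; set a := (_ == _).
have -> : (a%:R * u)^`M(i) = a%:R * u^`M(i).
  by case: a; rewrite ?mul1r ?mul0r ?mderiv0.
rewrite -!mul_mpolyC !mpolyC_nat.
by move: u^`M(i) u^`M(i)^`M(i) => p q; case: a; ring.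
Qed.

Lemma euler j u : u \is j.-homog -> \sum_i 'X_i * u^`M(i) = j%:R *: u.
Proof.
move=> hu; apply/mpolyP => m; rewrite raddf_sum mcoeffZ /=.
have [/eqP|nz] := eqVneq u@_m 0.
  move=> um; rewrite (eqP um) mulr0 big1 // => i _; rewrite mcoeff_mulX.
  case: eqP => // /eqP m_i; rewrite mcoeff_deriv submK ?lep1mP //.
  by rewrite (eqP um) mul0rn.
have <- : mdeg m = j by apply: (dhomog_mf hu); rewrite mcoeff_msupp.
rewrite mdegE natr_sum mulr_suml; apply: eq_bigr => i _; rewrite mcoeff_mulX.
case: (eqVneq (m i) 0%N) => [->|m_i]; first by rewrite mul0r.
rewrite mcoeff_deriv submK ?lep1mP // mnmBE mnm1E eqxx subn1 prednK ?lt0n //.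
by rewrite mulr_natl.
Qed.

(** The commutator relation of sl_2: by Euler's formula the first-order terms of [lower_mulX] add up
    to a multiple of [u], and the scalar is the weight of degree [j]. *)
Lemma lowering_mul_ell j u : u \is j.-homog ->
  lowering (ell * u) = ell * lowering u + (socle_degree%:R - (2 * j)%:R) *: u.
Proof.
move=> hu; have lowD i : {morph lower i : p q / p + q}.
  move=> p q; rewrite /lower !mderivD scalerDr mulrDr; ring.
have low0 i : lower i 0 = 0 by rewrite /lower !mderiv0 scaler0 mulr0 subr0.
have -> : lowering (ell * u) =
    \sum_i (ell * lower i u + ((e i).-1%:R *: u - 2%:R *: ('X_i * u^`M(i)))).
  apply: eq_bigr => i _; rewrite /ell mulr_suml (big_morph _ (lowD i) (low0 i)).
  rewrite mulr_suml (bigD1 i) //= [in RHS](bigD1 i) //= lower_mulX eqxx mul1r.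
  rewrite [RHS]addrAC; congr (_ + _); apply: eq_bigr => k ki.
  by rewrite lower_mulX eq_sym (negbTE ki) mul0r addr0.
rewrite big_split /= -mulr_sumr; congr (_ + _).
rewrite sumrB -scaler_suml -natr_sum -/socle_degree -scaler_sumr (euler hu).
by rewrite scalerA -natrM scalerBl.
Qed.

Lemma ell_homog : ell \is 1.-homog.
Proof. by apply: rpred_sum => i _; rewrite dhomogX /= mdeg1. Qed.

Lemma lowering_homog j u : u \is j.-homog -> lowering u \is j.-1.-homog.
Proof.
move=> hu; apply/dhomogP => m; rewrite mcoeff_msupp /lowering raddf_sum => nz.
have [i nz_i] : exists i, (lower i u)@_m != 0.
  apply: contrapT => all0; case/eqP: nz; apply: big1 => i _; apply/eqP.
  by apply: contrapT => /negP nzi; apply: all0; exists i.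
move: nz_i; rewrite mcoeff_lower mulf_eq0 negb_or => /andP [_].
rewrite -mcoeff_msupp => /(dhomog_mf hu) /=.
by rewrite mdegD mdeg1 addn1 => <-.
Qed.

(** [z] is primitive up to [null]. The scalar is the sum of the weights [socle_degree - 2 (j + i)]
    over [i <= k]. *)
Lemma lowering_ellX j k z : z \is j.-homog -> null (lowering z) ->
  exists2 y, null y & lowering (ell ^+ k.+1 * z) =
    (k.+1%:R * (socle_degree%:R - (2 * j + k)%:R)) *: (ell ^+ k * z) + y.
Proof.
move=> hz nz.
have null_ell u : null u -> null (ell * u).
  by move=> nu v; rewrite form_sym form_adjoint form_nulll // conjC0.
elim: k => [|k [y ny IHk]].
  exists (ell * lowering z); first exact: null_ell.
  by rewrite expr1 (lowering_mul_ell hz) expr0 !mul1r addn0 addrC.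
exists (ell * y); first exact: null_ell.
have hk : ell ^+ k.+1 * z \is (k.+1 + j).-homog.
  by apply: dhomogM hz; have := dhomogMn k.+1 ell_homog; rewrite mul1n.
rewrite exprS -mulrA (lowering_mul_ell hk) IHk mulrDr -scalerAr mulrA -exprS.
rewrite addrAC -scalerDl; congr (_ *: _ + _).
by rewrite -[k.+2]addn2 -[k.+1]addn1 !(natrD, natrM); ring.
Qed.

(** With s the socle degree, the squared norm of [ell ^+ i.+1 * z] is [i.+1 * (s - 2 j - i)] times
    that of [ell ^+ i * z]. If s < 2 j the factor at [i = 0] is negative, so [z] has norm zero.
    Otherwise the factor vanishes at [i = s - 2 j], so [ell ^+ k * z] is null, and its pairing with
    [w] is the norm of [z]. *)
Lemma lowering_primitive j w z k : z \is j.-homog -> null (lowering z) ->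
  z = iter k lowering w -> (socle_degree < 2 * j + k)%N -> null z.
Proof.
move=> hz nz ez ltk; apply: null_of_form0.
have norm i : form (ell ^+ i.+1 * z) (ell ^+ i.+1 * z) =
    (i.+1%:R * (socle_degree%:R - (2 * j + i)%:R)) *
    form (ell ^+ i * z) (ell ^+ i * z).
  have [y ny ey] := lowering_ellX i hz nz.
  rewrite {1}exprS -mulrA form_adjoint ey form_sym formDl formZl.
  by rewrite (form_nulll _ ny) addr0 rmorphM /= -form_sym rmorphM rmorphB
    /= !conjC_nat.
have [lt_j|le_j] := ltnP socle_degree (2 * j)%N.
  have := form_ge0 (ell ^+ 1 * z); rewrite norm mul1r addn0 expr0 mul1r.
  rewrite nmulr_rge0 ?subr_lt0 ?ltr_nat // => le0.
  by apply/eqP; rewrite eq_le le0 form_ge0.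
pose p := (socle_degree - 2 * j)%N.
have null_p i : (p < i)%N -> null (ell ^+ i * z).
  elim: i => // i IHi; rewrite ltnS leq_eqVlt => /orP [/eqP <-|/IHi ni].
    by apply: null_of_form0; rewrite norm /p subnKC // subrr mulr0 mul0r.
  by move=> v; rewrite exprS -mulrA form_sym form_adjoint form_nulll // conjC0.
have adj i u v : form (ell ^+ i * u) v = form u (iter i lowering v).
  elim: i u => [|i IHi] u; first by rewrite expr0 mul1r.
  by rewrite exprSr -mulrA IHi form_adjoint -iterS.
rewrite {2}ez -adj; apply: form_nulll; apply: null_p.
by rewrite /p; move: ltk le_j; lia.
Qed.

Lemma iter_lowering_homog j b w :
  w \is j.-homog -> iter b lowering w \is (j - b).-homog.
Proof.
move=> hw; elim: b => [|b IHb]; first by rewrite subn0.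
by rewrite iterS subnS; apply: lowering_homog.
Qed.

Lemma iter_lowering_inj j b w : w \is j.-homog -> (b <= j)%N ->
  (socle_degree + b <= 2 * j)%N -> null (iter b lowering w) -> null w.
Proof.
move=> hw; elim: b => // b IHb lt_b le_s nb; apply: IHb; first exact: ltnW.
  by move: le_s; lia.
apply: (@lowering_primitive (j - b) w _ b) => //.
  exact: iter_lowering_homog.
by move: le_s lt_b; lia.
Qed.

Lemma form_iter_adjoint i u v : form (ell ^+ i * u) v = form u (iter i lowering v).
Proof.
elim: i u => [|i IHi] u; first by rewrite expr0 mul1r.
by rewrite exprSr -mulrA IHi form_adjoint -iterS.
Qed.

Lemma form_homog_neq j j' u v : u \is j.-homog -> v \is j'.-homog -> j != j' ->
  form u v = 0.
Proof.
move=> hu hv ne; rewrite /form big_seq big1 // => m m_u.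
rewrite (dhomog_nemf_coeff hv) ?conjC0 ?mulr0 //.
by rewrite (dhomog_mf hu m_u).
Qed.

(* A linear functional vanishing on [ell ^+ b * S_(j - b)] is [form _ w] for
   some [w] supported on the box, and then [iter b lowering w] is null. *)
Lemma lefschetz j b p : (b <= j)%N -> (socle_degree + b <= 2 * j)%N ->
  p \is j.-homog -> exists c0, exists c : 'I_n -> {mpoly K[n]},
  p = c0 * ell ^+ b + \sum_l c l * 'X_l ^+ e l.
Proof.
move=> le_b le_s hp.
have hX l : ('X_l ^+ e l : {mpoly K[n]}) \is (e l).-homog.
  by rewrite mpolyXn dhomogX /= mdegMn mdeg1 mul1n.
have box_part q : q \is j.-homog -> exists c : 'I_n -> {mpoly K[n]},
    q = \sum_(m in box e j) q@_m *: 'X_[m] + \sum_l c l * 'X_l ^+ e l.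
  move=> hq; have [_ [c [_ _ ->]]] := Psi_box_part e_gt0 hX hq.
  move=> eq; exists c; rewrite -eq /Psi [LHS]mpolyE.
  by apply: eq_bigr => m _; rewrite psi_monX.
pose T := [set m : 'X_{1..n < (j - b).+1} | mdeg m == (j - b)%N].
have hT (a : 'I_#|T|) : mdeg (enum_val a : 'X_{1..n < _}) = (j - b)%N.
  by have := enum_valP a; rewrite inE => /eqP.
have hellT (a : 'I_#|T|) :
    ell ^+ b * 'X_[enum_val a : 'X_{1..n < (j - b).+1}] \is j.-homog.
  have hX_a : ('X_[enum_val a : 'X_{1..n < _}] : {mpoly K[n]}) \is (j - b).-homog.
    by rewrite dhomogX /= hT.
  by have := dhomogM (dhomogMn b ell_homog) hX_a; rewrite mul1n subnKC.
pose A := \matrix_(a < #|T|, m < #|box e j|)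
  (ell ^+ b * 'X_[enum_val a : 'X_{1..n < (j - b).+1}])@_(enum_val m : 'X_{1..n < _}).
have [fullA|] := boolP (row_full A).
  pose t := \row_(m < #|box e j|) p@_(enum_val m : 'X_{1..n < _}).
  have [u ut] : exists u : 'rV_#|T|, t = u *m A by apply/submxP/submx_full.
  pose c0 := \sum_(a < #|T|) u 0 a *: 'X_[enum_val a : 'X_{1..n < (j - b).+1}].
  have [|c ec] := box_part (p - c0 * ell ^+ b).
    rewrite rpredB // mulr_suml; apply: rpred_sum => a _.
    by rewrite -scalerAl mulrC; apply: dhomogZ.
  exists c0, c; apply/eqP; rewrite -subr_eq0 opprD addrA ec subr_eq0 big1 ?add0r //.
  move=> m m_box; rewrite (_ : _@__ = 0) ?scale0r //.
  have /rowP/(_ (enum_rank_in m_box m)) := ut; rewrite !mxE enum_rankK_in //.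
  rewrite mcoeffB => ->; apply/eqP; rewrite subr_eq0; apply/eqP.
  rewrite mulr_suml raddf_sum; apply: eq_bigr => a _ /=.
  by rewrite !mxE -scalerAl mcoeffZ mulrC enum_rankK_in // mulrC [ell ^+ _ * _]mulrC.
rewrite /row_full -mxrank_tr => ltA.
have [v nz_v vA] : exists2 v : 'rV_#|box e j|, v != 0 & v *m A^T = 0.
  exists (nz_row (kermx A^T)); last by apply/sub_kermxP; apply: nz_row_sub.
  rewrite nz_row_eq0 -mxrank_eq0 mxrank_ker subn_eq0 -ltnNge ltn_neqAle.
  by rewrite ltA rank_leq_row.
pose w := \sum_(m < #|box e j|)
  ((v 0 m)^* / (wt (enum_val m : 'X_{1..n < _}))%:R) *: 'X_[enum_val m : 'X_{1..n < _}].
have boxP (m : 'I_#|box e j|) : mdeg (enum_val m : 'X_{1..n < _}) = j /\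
    forall i, ((enum_val m : 'X_{1..n < _}) i < e i)%N.
  by have := enum_valP m; rewrite inE => /andP [/eqP ? /forallP].
have hw : w \is j.-homog.
  apply: rpred_sum => m _; apply: dhomogZ; rewrite dhomogX /=.
  by case: (boxP m) => ->.
have formw u : form u w = \sum_m v 0 m * u@_(enum_val m : 'X_{1..n < _}).
  rewrite form_sym form_suml rmorph_sum; apply: eq_bigr => m _ /=.
  rewrite formZl formXl !rmorphM /= !conjCK fmorphV /= !conjC_nat.
  have nz : (wt (enum_val m : 'X_{1..n < _}))%:R != 0 :> K.
    by rewrite pnatr_eq0 -lt0n wt_gt0 //; case: (boxP m).
  by rewrite mulrA divfK.
have nw : null w.
  apply: (iter_lowering_inj hw le_b le_s) => u.
  rewrite -form_iter_adjoint; elim/mpolyind: u => [|c m u _ _ IHu].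
    by rewrite mulr0 form0l.
  rewrite mulrDr formDl IHu addr0 -scalerAr formZl.
  have [dm|dm] := eqVneq (mdeg m) (j - b)%N; last first.
    rewrite (form_homog_neq _ hw (j := (b + mdeg m)%N)) ?mulr0 //.
      apply: dhomogM; last by rewrite dhomogX.
      by have := dhomogMn b ell_homog; rewrite mul1n.
    by apply: contra dm => /eqP <-; rewrite addKn.
  have lt_m : (mdeg m < (j - b).+1)%N by rewrite dm.
  have m_T : BMultinom lt_m \in T by rewrite inE /= dm.
  rewrite formw -[RHS](mulr0 c); congr (_ * _).
  have /rowP/(_ (enum_rank_in m_T (BMultinom lt_m))) := vA; rewrite !mxE => vA0.
  by apply: etrans vA0; apply: eq_bigr => m' _; rewrite !mxE enum_rankK_in.
case/eqP: nz_v; apply/rowP => m; rewrite mxE.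
have := nw 'X_[enum_val m : 'X_{1..n < _}]; rewrite formw (bigD1 m) //= mcoeffX eqxx.
rewrite mulr1 big1 ?addr0 // => m' m'm; rewrite mcoeffX.
by rewrite -bmeqP (inj_eq enum_val_inj) eq_sym (negbTE m'm) mulr0.
Qed.

End Lefschetz.

(** * Hilbert functions of monomial complete intersections *)

Section BoxCount.

(** The q-analogue of [a], which is the Hilbert series of K[x]/(x^a). *)
Definition qint a : {poly int} := \poly_(k < a) 1.

Lemma coef_qintM (p : {poly int}) a j :
  (p * qint a)`_j = \sum_(k < a | (k <= j)%N) p`_(j - k).
Proof.
rewrite /qint poly_def mulr_sumr coef_sum [RHS]big_mkcond; apply: eq_bigr => k _.
by rewrite scale1r coefMXn ltnNge; case: leqP.
Qed.

Lemma card_box n (e : 'I_n -> nat) j :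
  (#|box e j|)%:Z = (\prod_i qint (e i))`_j.
Proof.
pose D := (\max_i e i)%N.
have leD i : (e i <= D)%N by apply: leq_bigmax.
pose A := [set f : {ffun 'I_n -> 'I_D} |
  (\sum_i f i == j)%N && [forall i, f i < e i]%N].
pose mon (f : {ffun 'I_n -> 'I_D}) := [multinom (f i : nat) | i < n].
pose h f : 'X_{1..n < j.+1} := insubd bm0 (mon f).
have hE f : f \in A -> h f = mon f :> 'X_{1..n}.
  rewrite inE => /andP [/eqP df _]; rewrite /h /insubd insubT //.
  by rewrite mdegE (eq_bigr (fun i => f i : nat)) ?df // => i _; rewrite mnmE.
have -> : box e j = h @: A.
  apply/setP => m; apply/idP/imsetP => [|[f fA ->]]; last first.
    move: (fA); rewrite !inE hE // => /andP [/eqP df /forallP ltf].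
    apply/andP; split; last by apply/forallP => i; rewrite mnmE.
    by rewrite mdegE -df; apply/eqP/eq_bigr => i _; rewrite mnmE.
  rewrite inE => /andP [/eqP dm /forallP ltm].
  pose f := [ffun i => Ordinal (leq_trans (ltm i) (leD i))].
  have mf : mon f = m by apply/mnmP => i; rewrite mnmE ffunE.
  have fA : f \in A.
    rewrite inE -dm mdegE; apply/andP; split; last first.
      by apply/forallP => i; rewrite ffunE /= ltm.
    by apply/eqP/eq_bigr => i _; rewrite ffunE.
  by exists f => //; apply: val_inj; rewrite /= hE.
rewrite card_in_imset => [|f g fA gA /(congr1 val)]; last first.
  rewrite /= !hE // => /mnmP fg; apply/ffunP => i; apply: val_inj.
  by have := fg i; rewrite !mnmE.
have qE i : qint (e i) = \sum_(k < D) (k < e i)%N%:R *: 'X^k.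
  apply/polyP => k; rewrite coef_poly coef_sum.
  have [lt_k|le_k] := ltnP k (e i); last first.
    rewrite big1 // => l _; rewrite coefZ coefXn; case: eqP => [<-|_].
      by rewrite ltnNge le_k mul0r.
    by rewrite mulr0.
  rewrite (bigD1 (Ordinal (leq_trans lt_k (leD i)))) //= coefZ coefXn eqxx lt_k.
  rewrite mulr1 big1 ?addr0 // => l; rewrite -val_eqE /= => lk.
  by rewrite coefZ coefXn eq_sym (negbTE lk) mulr0.
rewrite (eq_bigr _ (fun i _ => qE i)) bigA_distr_bigA coef_sum /=.
rewrite -natz -sum1_card natr_sum big_mkcond; apply: eq_bigr => f _ /=.
have -> : \prod_i ((f i < e i)%N%:R *: 'X^(f i)) =
    [forall i, f i < e i]%N%:R *: 'X^(\sum_i f i) :> {poly int}.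
  have [/forallP ltf|] := boolP [forall i, f i < e i]%N; last first.
    rewrite negb_forall => /existsP [i /negbTE nlt].
    by rewrite (bigD1 i) //= nlt !scale0r mul0r.
  rewrite scale1r expr_sum.
  by apply: eq_bigr => i _; rewrite ltf scale1r.
rewrite coefZ coefXn inE eq_sym.
by case: (_ == _); case: [forall _, _].
Qed.

(** The centre of symmetry is s / 2. The last clause compares [i] with every larger [j] that is at
    most as far from the centre, so [j] may lie beyond it. *)
Definition sym_unimodal (p : {poly int}) s :=
  [/\ forall i, 0 <= p`_i, forall i, (s < i)%N -> p`_i = 0,
      forall i j, (i + j = s)%N -> p`_i = p`_j
    & forall i j, (i <= j)%N -> (i + j <= s)%N -> p`_i <= p`_j].

Lemma sym_unimodal1 : sym_unimodal 1 0.
Proof.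
split=> [i|i|i j|i j]; rewrite ?coef1; first by rewrite ler0n.
- by case: i.
- by case: i => [|i]; case: j.
- by case: i => [|i]; case: j.
Qed.

(** A coefficient of the product sums a window of [a.+1] coefficients of [p]. Moving the window from
    [i] to [i.+1] trades the index [i - a] for [i + 1], and their sum is at most [s] in the first
    half. *)
Lemma sym_unimodalM p s a : sym_unimodal p s ->
  sym_unimodal (p * qint a.+1) (s + a).
Proof.
move=> [p_ge0 p_big p_sym p_uni].
have q_sym i j : (i + j = s + a)%N -> (p * qint a.+1)`_i = (p * qint a.+1)`_j.
  move=> ij; rewrite !coef_qintM big_mkcond [RHS]big_mkcond.
  rewrite (reindex_inj rev_ord_inj); apply: eq_bigr => k _ /=.
  have lt_k := ltn_ord k; rewrite subSS.
  case: leqP => le1; case: leqP => le2 //.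
  - by apply: p_sym; lia.
  - by apply: p_big; lia.
  - by apply/esym/p_big; lia.
have step i : ((2 * i).+1 <= s + a)%N ->
    (p * qint a.+1)`_i <= (p * qint a.+1)`_i.+1.
  move=> le_i; rewrite !coef_qintM big_mkcond [leRHS]big_mkcond.
  rewrite big_ord_recr [leRHS]big_ord_recl /= addrC subn0; apply: lerD.
    case: leqP => // le_a; apply: p_uni; lia.
  rewrite le_eqVlt; apply/orP; left; apply/eqP; apply: eq_bigr => k _.
  by rewrite /bump add1n ltnS subSS.
have chain i j : (i <= j)%N -> ((2 * j) <= (s + a).+1)%N ->
    (p * qint a.+1)`_i <= (p * qint a.+1)`_j.
  elim: j => [|j IHj]; first by rewrite leqn0 => /eqP ->.
  rewrite leq_eqVlt => /orP [/eqP -> //|lt_i] le_j.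
  by apply: le_trans (IHj _ _) (step _ _); lia.
split=> // [i|i lt_i|i j le_ij le_s].
- by rewrite coef_qintM; apply: sumr_ge0.
- rewrite coef_qintM; apply: big1 => k le_k; apply: p_big.
  by have := ltn_ord k; lia.
- have [le_j|lt_j] := leqP (2 * j) (s + a).+1; first exact: chain.
  rewrite (q_sym j (s + a - j)%N); last lia.
  by apply: chain; lia.
Qed.

Lemma coef_qintM0 p a : (p * qint a.+1)`_0 = p`_0.
Proof. by rewrite coef_qintM big_mkcond big_ord_recl /= big1 ?addr0. Qed.

Lemma coef_qintM1 p a : (p * qint a.+1)`_1 = p`_1 + (if (0 < a)%N then p`_0 else 0).
Proof.
rewrite coef_qintM big_mkcond big_ord_recl /= subn0; congr (_ + _).
case: a => [|a]; first by rewrite big_ord0.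
by rewrite big_ord_recl /= big1 ?addr0.
Qed.

Lemma coef_qintM2 p a : (p * qint a.+1)`_2 =
  p`_2 + (if (0 < a)%N then p`_1 else 0) + (if (1 < a)%N then p`_0 else 0).
Proof.
rewrite coef_qintM big_mkcond big_ord_recl /= subn0 -addrA; congr (_ + _).
case: a => [|a]; first by rewrite big_ord0 addr0.
rewrite big_ord_recl /=; congr (_ + _).
case: a => [|a]; first by rewrite big_ord0.
by rewrite big_ord_recl /= big1 ?addr0.
Qed.

Section Pairs.

Variable d : nat.

(** The Hilbert series of a complete intersection with degrees [a i] and [d - a i]. *)
Definition pairs k (a : 'I_k -> nat) : {poly int} :=
  \prod_(i < k) (qint (a i) * qint (d - a i)).

Lemma pairsS k (a : 'I_k.+1 -> nat) :
  pairs a = pairs (fun i => a (widen_ord (leqnSn k) i))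
    * qint (a ord_max) * qint (d - a ord_max).
Proof. by rewrite /pairs big_ord_recr /= mulrA. Qed.

Lemma pairs_sym_unimodal k (a : 'I_k -> nat) :
  (forall i, 0 < a i < d)%N -> sym_unimodal (pairs a) (k * (d - 2)).
Proof.
elim: k a => [|k IHk] a lta; first by rewrite /pairs big_ord0; apply: sym_unimodal1.
rewrite pairsS; have /andP [] := lta ord_max; case: (a ord_max) => // x _ lt_x.
have -> : (d - x.+1 = (d - x.+2).+1)%N by lia.
have -> : (k.+1 * (d - 2) = k * (d - 2) + x + (d - x.+2))%N by rewrite mulSn; lia.
by apply/sym_unimodalM/sym_unimodalM/IHk => i.
Qed.

Lemma pairs_coef0 k (a : 'I_k -> nat) :
  (forall i, 0 < a i < d)%N -> (pairs a)`_0 = 1.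
Proof.
elim: k a => [|k IHk] a lta; first by rewrite /pairs big_ord0 coef1.
rewrite pairsS; have /andP [] := lta ord_max; case: (a ord_max) => // x _ lt_x.
have -> : (d - x.+1 = (d - x.+2).+1)%N by lia.
by rewrite !coef_qintM0 IHk.
Qed.

Lemma pairs_coef_gt0 k (a : 'I_k.+1 -> nat) : (3 < d)%N ->
  (forall i, 0 < a i < d)%N -> 1 <= (pairs a)`_1 /\ 1 <= (pairs a)`_2.
Proof.
move=> lt3 lta.
have lta' i : (0 < a (widen_ord (leqnSn k) i) < d)%N by [].
rewrite pairsS.
have [p_ge0 _ _ _] := pairs_sym_unimodal lta'; have p0 := pairs_coef0 lta'.
move: (pairs _) p_ge0 p0 => p p_ge0 p0.
have /andP [] := lta ord_max; case: (a ord_max) => // x _ lt_x.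
have -> : (d - x.+1 = (d - x.+2).+1)%N by lia.
rewrite coef_qintM1 coef_qintM2 !(coef_qintM0, coef_qintM1, coef_qintM2) p0.
move: (p`_1) (p`_2) (p_ge0 1%N) (p_ge0 2%N) => y z p1 p2.
case: x lt_x => [|[|x]] lt_x /=; repeat (case: ltnP => ? /=); lia.
Qed.

(** For [d = 3] the degrees of each pair are [1] and [2], so [pairs a] is (1 + X)^k. *)
Lemma pairs3_coef k (a : 'I_k -> nat) : d = 3%N ->
  (forall i, 0 < a i < d)%N ->
  (pairs a)`_1 = k%:Z /\ 2 * (pairs a)`_2 = k%:Z * (k%:Z - 1).
Proof.
move=> d3; elim: k a => [|k IHk] a lta.
  by rewrite /pairs big_ord0 !coef1 /= !mul0r mulr0.
have lta' i : (0 < a (widen_ord (leqnSn k) i) < d)%N by [].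
have [p1 p2] := IHk _ lta'; have p0 := pairs_coef0 lta'.
rewrite pairsS; move: (pairs _) p0 p1 p2 => p p0 p1 p2.
have /andP [] := lta ord_max; case: (a ord_max) => // x _ lt_x.
have -> : (d - x.+1 = (d - x.+2).+1)%N by lia.
rewrite coef_qintM1 coef_qintM2 !(coef_qintM0, coef_qintM1, coef_qintM2) p0 p1.
have : x = 0%N \/ x = 1%N by lia.
by case=> ->; rewrite d3 /=; move: p2; move: p`_2 => y p2; split; nia.
Qed.

(** This is the source of strictness in [pairs_gap]. For [d = 3] the coefficients are binomial and
    [5 <= k]; for larger [d] one pair is split off, the coefficients of the others in degrees 1 and
    2 being at least [1]. *)
Lemma pairs_coef12 k (a : 'I_k -> nat) : (2 < d)%N ->
  (d + 2 <= k * (d - 2))%N -> (forall i, 0 < a i < d)%N ->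
  (pairs a)`_1 < (pairs a)`_2.
Proof.
move=> lt2 le_k lta; have [lt3|le3] := ltnP 3 d; last first.
  have d3 : d = 3%N by lia.
  have [-> p2] := pairs3_coef d3 lta.
  have : (5 <= k)%N by move: le_k; rewrite d3; lia.
  by move: p2; move: ((pairs a)`_2) => y; nia.
case: k a le_k lta => [|[|k]] a le_k lta; [lia|lia|].
have lta' i : (0 < a (widen_ord (leqnSn k.+1) i) < d)%N by [].
have [p1 p2] := pairs_coef_gt0 lt3 lta'; have p0 := pairs_coef0 lta'.
rewrite pairsS; move: (pairs _) p0 p1 p2 => p p0 p1 p2.
have /andP [] := lta ord_max; case: (a ord_max) => // x _ lt_x.
have -> : (d - x.+1 = (d - x.+2).+1)%N by lia.
rewrite coef_qintM1 coef_qintM2 !(coef_qintM0, coef_qintM1, coef_qintM2) p0.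
move: (p`_1) (p`_2) p1 p2 => y z p1 p2.
case: x lt_x => [|[|x]] lt_x /=; repeat (case: ltnP => ? /=); lia.
Qed.

(* The difference of the two coefficients is
   [\sum_(t < minn x (d - x)) (g_(d - t) - g_(t + 1))] for [g := pairs a]. *)
Lemma pairs_gap k (a : 'I_k -> nat) x : (2 < d)%N ->
  (d + 2 <= k * (d - 2))%N -> (forall i, 0 < a i < d)%N -> (0 < x < d)%N ->
  (pairs a * qint x)`_x < (pairs a * qint x)`_d.
Proof.
move=> lt2 le_k lta /andP [x_gt0 lt_x].
have [g_ge0 _ _ g_uni] := pairs_sym_unimodal lta.
have g12 := pairs_coef12 lt2 le_k lta; move: (pairs a) g_ge0 g_uni g12 => g.
move=> g_ge0 g_uni g12.
have coefx y : (x <= y)%N -> (g * qint x)`_y = \sum_(t < x) g`_(y - t).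
  move=> le_xy; rewrite coef_qintM; apply: eq_bigl => t.
  by rewrite (leq_trans (ltnW (ltn_ord t)) le_xy).
rewrite !coefx ?(ltnW lt_x) //.
suff main c : (0 < c)%N -> (2 * c <= d)%N ->
    \sum_(t < c) g`_(c - t) < \sum_(t < c) g`_(d - t).
  have [le_x|lt_dx] := leqP (2 * x) d; first exact: main.
  (* The index ranges 1..x and d - x + 1..d now overlap, and their [c'] common terms cancel. *)
  pose c := (d - x)%N; pose c' := (x - c)%N.
  have -> : \sum_(t < x) g`_(x - t) =
      \sum_(t < c') g`_(x - t) + \sum_(t < c) g`_(c - t).
    have ex : (x = c' + c)%N by lia.
    rewrite [in LHS]ex big_split_ord /=; congr (_ + _).
      by apply: eq_bigr => t _; congr (_ `_ _); lia.
    by apply: eq_bigr => t _; congr (_ `_ _); lia.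
  have -> : \sum_(t < x) g`_(d - t) =
      \sum_(t < c') g`_(x - t) + \sum_(t < c) g`_(d - t).
    have ex : (x = c + c')%N by lia.
    rewrite [in LHS]ex big_split_ord /= addrC; congr (_ + _).
    by apply: eq_bigr => t _; congr (_ `_ _); lia.
  by rewrite ltrD2l; apply: main; lia.
case: c => // c _ le_c.
rewrite (reindex_inj rev_ord_inj) /= big_ord_recl [ltRHS]big_ord_recl /=.
apply: ltr_leD.
  (* Here g_1 < g_2 <= g_d, the latter because [2 + d <= k * (d - 2)]; the remaining terms compare
     indices of sum d + 1. *)
  rewrite subn0 subSS subn0 subSnn; apply: lt_le_trans g12 _.
  by apply: g_uni; lia.
apply: ler_sum => t _; have := ltn_ord t; rewrite /bump add1n => lt_t.
by apply: g_uni; lia.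
Qed.

End Pairs.

End BoxCount.

(** * Generic forms and products of forms *)

Section PolynomialFamilies.

Variables (K : fieldType) (N : nat).
Implicit Types (x v : 'I_N -> K).

Definition polyfun (f : ('I_N -> K) -> K) :=
  exists p : {mpoly K[N]}, forall x, p.@[x] = f x.

Lemma polyfun_const c : polyfun (fun=> c).
Proof. by exists c%:MP => x; rewrite mevalC. Qed.

Lemma polyfunM f g : polyfun f -> polyfun g -> polyfun (fun x => f x * g x).
Proof. by move=> [p pP] [q qP]; exists (p * q) => x; rewrite mevalM pP qP. Qed.

Lemma polyfun_sum I (r : seq I) (P : pred I) (f : I -> ('I_N -> K) -> K) :
  (forall i, polyfun (f i)) -> polyfun (fun x => \sum_(i <- r | P i) f i x).
Proof.
move=> pf; elim: r => [|i r [q qP]].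
  by exists 0 => x; rewrite meval0 big_nil.
case P_i : (P i); last by exists q => x; rewrite big_cons P_i.
have [p pP] := pf i.
by exists (p + q) => x; rewrite mevalD pP qP big_cons P_i.
Qed.

Lemma polyfun_prod I (r : seq I) (P : pred I) (f : I -> ('I_N -> K) -> K) :
  (forall i, polyfun (f i)) -> polyfun (fun x => \prod_(i <- r | P i) f i x).
Proof.
move=> pf; elim: r => [|i r [q qP]].
  by exists 1 => x; rewrite meval1 big_nil.
case P_i : (P i); last by exists q => x; rewrite big_cons P_i.
have [p pP] := pf i.
by exists (p * q) => x; rewrite mevalM pP qP big_cons P_i.
Qed.

Lemma polyfun_det k (M : ('I_N -> K) -> 'M[K]_k) :
  (forall i j, polyfun (fun x => M x i j)) -> polyfun (fun x => \det (M x)).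
Proof.
move=> pf; apply: polyfun_sum => s; apply: polyfunM; first exact: polyfun_const.
by apply: polyfun_prod => i.
Qed.

Definition polyfam n (h : ('I_N -> K) -> {mpoly K[n]}) :=
  forall m, polyfun (fun x => (h x)@_m).

Lemma polyfam_const n (p : {mpoly K[n]}) : polyfam (fun=> p).
Proof. by move=> m; apply: polyfun_const. Qed.

Lemma polyfamM n (g h : ('I_N -> K) -> {mpoly K[n]}) :
  polyfam g -> polyfam h -> polyfam (fun x => g x * h x).
Proof.
move=> pg ph m.
have [p pP] : polyfun (fun x =>
    \sum_(k : 'X_{1..n < (mdeg m).+1, (mdeg m).+1} | m == (k.1 + k.2)%MM)
      ((g x)@_k.1 * (h x)@_k.2)).
  by apply: polyfun_sum => k; apply: polyfunM.
by exists p => x; rewrite pP mcoeffM.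
Qed.

Lemma polyfam_sum n I (r : seq I) (P : pred I)
    (f : I -> ('I_N -> K) -> {mpoly K[n]}) :
  (forall i, polyfam (f i)) -> polyfam (fun x => \sum_(i <- r | P i) f i x).
Proof.
move=> pf m.
have [p pP] : polyfun (fun x => \sum_(i <- r | P i) (f i x)@_m).
  by apply: polyfun_sum => i; apply: pf.
by exists p => x; rewrite pP raddf_sum.
Qed.

Lemma polyfam_prod n I (r : seq I) (P : pred I)
    (f : I -> ('I_N -> K) -> {mpoly K[n]}) :
  (forall i, polyfam (f i)) -> polyfam (fun x => \prod_(i <- r | P i) f i x).
Proof.
move=> pf; elim: r => [|i r pr] m.
  by have [p pP] := @polyfam_const n 1 m; exists p => x; rewrite pP big_nil.
case P_i : (P i); last by have [p pP] := pr m; exists p => x; rewrite pP big_cons P_i.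
have [p pP] := polyfamM (pf i) pr m.
by exists p => x; rewrite pP big_cons P_i.
Qed.

Lemma polyfamX n (f : ('I_N -> K) -> {mpoly K[n]}) k :
  polyfam f -> polyfam (fun x => f x ^+ k).
Proof.
move=> pf m; have [p pP] := polyfam_prod (index_enum 'I_k) xpredT (fun=> pf) m.
by exists p => x; rewrite pP prodr_const card_ord.
Qed.

Lemma polyfun_det_psi n (e : 'I_n -> nat) J
    (H : ('I_N -> K) -> 'I_n -> {mpoly K[n]}) :
  (forall i, polyfam (fun x => H x i)) ->
  polyfun (fun x => \det (psi_mx e (H x) J)).
Proof.
move=> pH; apply: polyfun_det => a b.
have pf : polyfam (fun x => psi_mon e (H x) (enum_val a : 'X_{1..n < J.+1})).
  apply: polyfamM; last exact: polyfam_const.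
  by apply: polyfam_prod => i; apply: polyfamX.
have [p pP] := pf (enum_val b : 'X_{1..n < J.+1}).
by exists p => x; rewrite pP mxE.
Qed.

End PolynomialFamilies.

Section GenericForms.

Variables (K : fieldType) (n d k : nat) (deg : 'I_k -> nat).
Hypothesis deg_leq : forall i, (deg i <= d)%N.

Let N := #|{: 'I_k * 'X_{1..n < d.+1}}|.

Definition gform (x : 'I_N -> K) (i : 'I_k) : {mpoly K[n]} :=
  \sum_(m : 'X_{1..n < d.+1} | mdeg m == deg i) x (enum_rank (i, m)) *: 'X_[m].

Lemma gform_homog x i : gform x i \is (deg i).-homog.
Proof.
by apply: rpred_sum => m dm; apply: dhomogZ; rewrite dhomogX.
Qed.

Lemma gform_polyfam i : polyfam (gform^~ i).
Proof.
apply: polyfam_sum => m m'.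
exists ('X_(enum_rank (i, m)) * (('X_[m] : {mpoly K[n]})@_m')%:MP) => x.
by rewrite mevalM mevalXU mevalC mcoeffZ.
Qed.

Lemma gform_lin t x v i :
  gform (fun j => x j + t * v j) i = gform x i + t *: gform v i.
Proof.
rewrite /gform scaler_sumr -big_split; apply: eq_bigr => m _ /=.
by rewrite scalerDl scalerA.
Qed.

Lemma gform_surj (G : 'I_k -> {mpoly K[n]}) :
  (forall i, G i \is (deg i).-homog) -> exists x, forall i, gform x i = G i.
Proof.
move=> hG; pose val_ (j : 'I_N) : 'I_k * 'X_{1..n < d.+1} := enum_val j.
exists (fun j => (G (val_ j).1)@_((val_ j).2)) => i.
have szG : (msize (G i) <= d.+1)%N.
  by apply: leq_trans (msize_homog (hG i)) _; rewrite ltnS.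
rewrite [RHS](mpolywE szG) /gform big_mkcond; apply: eq_bigr => m _.
rewrite /val_ enum_rankK /=; case: eqP => // /eqP dm.
by rewrite (dhomog_nemf_coeff (hG i)) ?scale0r.
Qed.

End GenericForms.

(** The values along a line determine a polynomial in [t], as the field is infinite, and [b] is its
    derivative at [0]. Degree two is what the bilinear product map requires. *)
Lemma directional_derivative (K : numFieldType) n (p : {mpoly K[n]})
    (x v : 'I_n -> K) a b c :
  (forall t, p.@[fun j => x j + t * v j] = a + t * b + t ^+ 2 * c) ->
  \sum_j (p^`M(j)).@[x] * v j = b.
Proof.
move=> pt; pose h j := (x j)%:P + v j *: 'X : {poly K}.
pose u := mmap (@polyC K) h p.
have evalE t q : (mmap (@polyC K) h q).[t] = q.@[fun j => x j + t * v j].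
  rewrite -horner_evalE mmap_comp_rmorph; apply: mmap_ext => [e|j].
    by rewrite /= horner_evalE hornerC.
  by rewrite /= horner_evalE hornerD hornerC hornerZ hornerX mulrC.
have uE : u = a%:P + b *: 'X + c *: 'X^2.
  apply/eqP; rewrite -subr_eq0; apply/eqP; apply: poly_vanish => t.
  rewrite hornerD hornerN !hornerD hornerC !hornerZ hornerX hornerXn.
  by rewrite evalE pt; ring.
have := @mmap_deriv _ _ _ (@polyC K) h (@deriv K) (@derivC K) (@derivM K) p.
rewrite -/u uE /= => /(congr1 (horner^~ 0)).
rewrite !derivD derivC !derivZ derivX derivXn !hornerD !hornerZ hornerC hornerMn.
rewrite hornerX mul0rn mulr0 hornerC mulr1 add0r addr0 => ->.
rewrite horner_sum; apply: eq_bigr => j _; rewrite hornerM evalE.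
rewrite derivD derivC derivZ derivX add0r hornerZ hornerC mulr1; congr (_ * _).
by apply: meval_eq => i; rewrite mul0r addr0.
Qed.

(** * The product map, its differential and generic containment *)

Section Assembly.

Variables (K : numClosedFieldType) (n d r : nat) (a : 'I_r -> nat).
Hypothesis a_bounds : forall i, (0 < a i < d)%N.

Definition fmon (i : 'I_#|form_monomial n d|) : 'X_{1..n.+1} :=
  val (enum_val i).

Lemma mdeg_fmon i : mdeg (fmon i) = d.
Proof. by rewrite /fmon; case: (enum_val i) => m /= /eqP. Qed.

Lemma fmon_inj : injective fmon.
Proof. by move=> i j /val_inj/val_inj/enum_val_inj. Qed.

Lemma fmon_surj (m : 'X_{1..n.+1}) : mdeg m = d -> exists i, fmon i = m.
Proof.
move=> dm; have lt_m : (mdeg m < d.+1)%N by rewrite dm.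
have dm' : mdeg (BMultinom lt_m) == d by apply/eqP.
exists (enum_rank (exist _ (BMultinom lt_m) dm' : form_monomial n d)).
by rewrite /fmon enum_rankK.
Qed.

Lemma homog_eq_fmon (p q : {mpoly K[n.+1]}) : p \is d.-homog -> q \is d.-homog ->
  (forall i, p@_(fmon i) = q@_(fmon i)) -> p = q.
Proof.
move=> hp hq eq_pq; apply/mpolyP => m.
have [/fmon_surj [i <-]|dm] := eqVneq (mdeg m) d; first exact: eq_pq.
by rewrite (dhomog_nemf_coeff hp dm) (dhomog_nemf_coeff hq dm).
Qed.

Definition deg (l : 'I_(r + r)) : nat :=
  match split l with inl i => a i | inr i => (d - a i)%N end.

(** Exchanges F_i and G_i: differentiating their product in one of them leaves the other as a
    factor. *)
Definition flip (l : 'I_(r + r)) : 'I_(r + r) :=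
  match split l with inl i => rshift r i | inr i => lshift r i end.

Lemma deg_lshift i : deg (lshift r i) = a i.
Proof. by rewrite /deg (unsplitK (inl i : 'I_r + 'I_r)). Qed.

Lemma deg_rshift i : deg (rshift r i) = (d - a i)%N.
Proof. by rewrite /deg (unsplitK (inr i : 'I_r + 'I_r)). Qed.

Lemma flip_lshift i : flip (lshift r i) = rshift r i.
Proof. by rewrite /flip (unsplitK (inl i : 'I_r + 'I_r)). Qed.

Lemma flip_rshift i : flip (rshift r i) = lshift r i.
Proof. by rewrite /flip (unsplitK (inr i : 'I_r + 'I_r)). Qed.

Lemma flipK : involutive flip.
Proof.
move=> l; rewrite -(splitK l); case: (split l) => i /=.
  by rewrite flip_lshift flip_rshift.
by rewrite flip_rshift flip_lshift.
Qed.

Lemma deg_bounds l : (0 < deg l < d)%N.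
Proof. by rewrite /deg; case: split => i; have := a_bounds i; lia. Qed.

Lemma deg_leq l : (deg l <= d)%N.
Proof. by have := deg_bounds l; lia. Qed.

Lemma deg_flip l : deg (flip l) = (d - deg l)%N.
Proof.
rewrite -(splitK l); case: (split l) => i /=.
  by rewrite flip_lshift deg_lshift deg_rshift.
by rewrite flip_rshift deg_lshift deg_rshift; have := a_bounds i; lia.
Qed.

Lemma sum_deg : (\sum_l (deg l).-1 = r * (d - 2))%N.
Proof.
rewrite big_split_ord /= -big_split /= -[r in RHS]card_ord -sum_nat_const.
apply: eq_bigr => i _; rewrite deg_lshift deg_rshift.
by have := a_bounds i; lia.
Qed.

Let N := #|{: 'I_(r + r) * 'X_{1..n.+1 < d.+1}}|.
Implicit Types x v : 'I_N -> K.

Local Notation form_ x l := (gform deg x l).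

(** The product map is [bil x x]; its derivative at [x] along [v] is [bil x v + bil v x]. *)
Definition bil x v : {mpoly K[n.+1]} :=
  \sum_(i < r) form_ x (lshift r i) * form_ v (rshift r i).

Definition spans x := forall p : {mpoly K[n.+1]}, p \is d.-homog ->
  exists c : 'I_(r + r) -> {mpoly K[n.+1]}, p = \sum_l c l * form_ x l.

Lemma bil_homog x v : bil x v \is d.-homog.
Proof.
apply: rpred_sum => i _.
have := dhomogM (gform_homog deg x (lshift r i)) (gform_homog deg v (rshift r i)).
rewrite deg_lshift deg_rshift subnKC //; have := a_bounds i; lia.
Qed.

Lemma bil_sym_sum x v :
  bil x v + bil v x = \sum_l form_ v (flip l) * form_ x l.
Proof.
rewrite big_split_ord /=; congr (_ + _); apply: eq_bigr => i _.
  by rewrite flip_lshift mulrC.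
by rewrite flip_rshift.
Qed.

Lemma product_map : exists q : 'I_#|form_monomial n d| -> {mpoly K[N]},
  forall x i, (q i).@[x] = (bil x x)@_(fmon i).
Proof.
have pf : polyfam (fun x => bil x x).
  by apply: polyfam_sum => i; apply: polyfamM; apply: gform_polyfam.
have /fin_all_exists [q qP] (i : 'I_#|form_monomial n d|) := pf (fmon i).
by exists q.
Qed.

Section Jacobian.

Variable q : 'I_#|form_monomial n d| -> {mpoly K[N]}.
Hypothesis qE : forall x i, (q i).@[x] = (bil x x)@_(fmon i).

Lemma jacobian_product x v :
  jacobian q x *m \col_j v j = \col_i (bil x v + bil v x)@_(fmon i).
Proof.
apply/colP => i; rewrite !mxE.
rewrite -[RHS](@directional_derivative _ _ (q i) x v (bil x x)@_(fmon i) _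
  (bil v v)@_(fmon i)); first by apply: eq_bigr => j _; rewrite !mxE.
move=> t; rewrite qE -!mcoeffZ -!mcoeffD; congr mcoeff.
rewrite /bil -big_split !scaler_sumr -!big_split; apply: eq_bigr => l _ /=.
rewrite !gform_lin -!mul_mpolyC expr2 mpolyCM; ring.
Qed.

Lemma spans_row_free x : spans x -> row_free (jacobian q x).
Proof.
move=> sp; apply/row_freeP.
have /fin_all_exists [v vP] (i : 'I_#|form_monomial n d|) :
    exists v, jacobian q x *m \col_j v j = \col_k (i == k)%:R.
  have hX : ('X_[fmon i] : {mpoly K[n.+1]}) \is d.-homog.
    by rewrite dhomogX /= mdeg_fmon.
  have [c0 ec0] := sp _ hX.
  have := hspan_pihomog (gform_homog deg x) d c0.
  rewrite -ec0 pihomog_dE // => -[c [hc _ ec]].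
  (* The cofactor of a form has the degree of its partner, so the cofactors, exchanged by [flip],
     form a direction of differentiation. *)
  have hc' l : c (flip l) \is (deg l).-homog.
    have := hc (flip l); rewrite deg_flip subKn //; exact: deg_leq.
  have [v vP] := gform_surj deg_leq hc'.
  exists v; rewrite jacobian_product; apply/colP => k; rewrite !mxE.
  rewrite bil_sym_sum (_ : \sum_l _ = 'X_[fmon i]); last first.
    rewrite ec; apply: eq_bigr => l _; rewrite vP; congr (c _ * _).
    exact: flipK.
  by rewrite mcoeffX (inj_eq fmon_inj).
exists (\matrix_(j, i) v i j); apply/matrixP => i k.
have /colP/(_ i) := vP k; rewrite !mxE eq_sym => <-.
by apply: eq_bigr => j _; rewrite !mxE.
Qed.

Lemma row_free_spans x : row_free (jacobian q x) -> spans x.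
Proof.
case/row_freeP => B JB p hp.
pose v j := (B *m \col_i p@_(fmon i)) j 0.
exists (fun l => form_ v (flip l)); rewrite -bil_sym_sum.
apply: homog_eq_fmon => [//||i]; first by rewrite rpredD ?bil_homog.
have := jacobian_product x v; have -> : \col_j v j = B *m \col_i p@_(fmon i).
  by apply/colP => j; rewrite mxE.
by rewrite mulmxA JB mul1mx => /colP/(_ i); rewrite !mxE.
Qed.

(** A right inverse [B] at [x0] makes the determinant of [jacobian q x *m B] a polynomial in [x]
    with value [1] at [x0]. *)
Lemma row_free_generic x0 : row_free (jacobian q x0) ->
  exists2 p : {mpoly K[N]}, p != 0 & forall x, p.@[x] != 0 -> row_free (jacobian q x).
Proof.
case/row_freeP => B JB.
have [p pP] : polyfun (fun x => \det (jacobian q x *m B)).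
  apply: polyfun_det => i j.
  have [p pP] : polyfun (fun x => \sum_k jacobian q x i k * B k j).
    apply: polyfun_sum => k; apply: polyfunM; last exact: polyfun_const.
    by exists (q i)^`M(k) => x; rewrite mxE.
  by exists p => x; rewrite pP mxE.
exists p.
  have := pP x0; rewrite JB det1; apply: contra_eqN => /eqP ->.
  by rewrite meval0 eq_sym oner_eq0.
move=> x; rewrite pP -unitfE -unitmxE => unitJB; apply/row_freeP.
exists (B *m invmx (jacobian q x *m B)).
by rewrite mulmxA mulmxV.
Qed.

End Jacobian.

Lemma det_psi_generic (e : 'I_n.+1 -> nat) J
    (H : ('I_N -> K) -> 'I_n.+1 -> {mpoly K[n.+1]}) x0 :
  (forall i, polyfam (fun x => H x i)) -> (forall i, H x0 i = 'X_i ^+ e i) ->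
  exists2 p : {mpoly K[N]}, p != 0 &
    forall x, p.@[x] != 0 -> psi_mx e (H x) J \in unitmx.
Proof.
move=> pH H0; have [p pP] := polyfun_det_psi e J pH.
exists p => [|x]; last by rewrite pP unitmxE unitfE.
apply/eqP => p0; have := pP x0; rewrite p0 meval0.
have -> : H x0 = fun i => 'X_i ^+ e i by apply/funext.
by rewrite psi_mxX det1 => /esym/eqP; rewrite oner_eq0.
Qed.

(* The degree of the [l]-th of the [r + r] forms, extended by [d.+1], so that
   the additional power [X_l ^+ d.+1] does not matter in degree [d]. *)
Definition degn (l : nat) : nat := oapp deg d.+1 (insub l).

Lemma degnE (l : 'I_(r + r)) : degn l = deg l.
Proof. by rewrite /degn valK. Qed.

Lemma degn_gt0 l : (0 < degn l)%N.
Proof. by rewrite /degn; case: insub => //= k; have := deg_bounds k; lia. Qed.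

Lemma sum_degn : (\sum_(l < r + r) (degn l).-1 = r * (d - 2))%N.
Proof. by rewrite -sum_deg; apply: eq_bigr => l _; rewrite degnE. Qed.

Lemma degn_lshift (i : 'I_r) : degn i = a i.
Proof. by rewrite -deg_lshift -degnE. Qed.

Lemma degn_rshift (i : 'I_r) : degn (r + i) = (d - a i)%N.
Proof. by rewrite -deg_rshift -degnE. Qed.

(** [psi_mx] takes one form per variable: missing ones are filled in with powers, and for
    [r + r = n.+2] the last form is left out. *)
Definition extended_form x (l : 'I_n.+1) : {mpoly K[n.+1]} :=
  oapp (gform deg x) ('X_l ^+ d.+1) (insub (l : nat)).

Lemma extended_form_homog x l : extended_form x l \is (degn l).-homog.
Proof.
rewrite /extended_form /degn; case: insub => /= [k|]; first exact: gform_homog.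
by rewrite mpolyXn dhomogX /= mdegMn mdeg1 mul1n.
Qed.

Lemma extended_form_generic J : exists2 p : {mpoly K[N]}, p != 0 &
  forall x, p.@[x] != 0 ->
    psi_mx (fun l : 'I_n.+1 => degn l) (extended_form x) J \in unitmx.
Proof.
have hG (k : 'I_(r + r)) :
    (oapp (fun i : 'I_n.+1 => 'X_i ^+ deg k) 0 (insub (k : nat)) : {mpoly K[n.+1]})
      \is (deg k).-homog.
  case: insub => /= [i|]; last exact: rpred0.
  by rewrite mpolyXn dhomogX /= mdegMn mdeg1 mul1n.
have [x0 x0P] := gform_surj deg_leq hG.
apply: (@det_psi_generic _ _ _ x0) => i; rewrite /extended_form /degn.
  by case: insub => /= [k|]; [apply: gform_polyfam|apply: polyfam_const].
by case: insubP => //= k _ kE; rewrite x0P kE valK.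
Qed.

Lemma generic_spanning q x0 :
  (forall x i, (q i).@[x] = (bil x x)@_(fmon i)) -> row_free (jacobian q x0) ->
  exists2 x, spans x &
    psi_mx (fun l : 'I_n.+1 => degn l) (extended_form x) d \in unitmx.
Proof.
move=> qE free_q; have [p nz_p pP] := row_free_generic free_q.
have [p' nz_p' pP'] := extended_form_generic d.
have [x] := mpoly_neq0_point (mulf_neq0 nz_p nz_p').
rewrite mevalM mulf_eq0 negb_or => /andP [px px'].
by exists x; [apply: (row_free_spans qE); apply: pP|apply: pP'].
Qed.

(** The top box monomial has degree at least [d], hence a divisor of degree [d]; this is again in
    the box and so outside the span. *)
Lemma not_spans_small x : (r + r <= n.+1)%N ->
  (d <= \sum_(l < n.+1) (degn l).-1)%N ->
  psi_mx (fun l : 'I_n.+1 => degn l) (extended_form x) d \in unitmx ->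
  ~ spans x.
Proof.
move=> le_rn le_d unit_d sp.
pose m := [multinom (degn i).-1 | i < n.+1].
have [|m1 le_m dm1] := @mnm_le_mdeg _ d m.
  by rewrite mdegE (eq_bigr (fun l : 'I_n.+1 => (degn l).-1)) // => l _; rewrite mnmE.
have ltm1 i : (m1 i < degn i)%N.
  by have /mnm_lepP/(_ i) := le_m; rewrite mnmE; have := degn_gt0 i; lia.
apply: (not_hspan_box (fun l => degn_gt0 l) (extended_form_homog x) unit_d
  (leqnn d) dm1 ltm1).
have hX : ('X_[m1] : {mpoly K[n.+1]}) \is d.-homog by rewrite dhomogX /= dm1.
have [c ec] := sp _ hX.
rewrite -(pihomog_dE hX) ec.
pose c' (l : 'I_n.+1) := oapp c 0 (insub (l : nat)).
rewrite (_ : \sum_l _ = \sum_l c' l * extended_form x l).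
  exact: hspan_pihomog (extended_form_homog x) d c'.
rewrite (bigID (fun l : 'I_n.+1 => (l < r + r)%N)) /= [X in _ = _ + X]big1 ?addr0.
  rewrite (big_ord_narrow le_rn) /=; apply: eq_bigr => l _.
  by rewrite /c' /extended_form /= valK.
by move=> l nlt; rewrite /c' insubN // mul0r.
Qed.

(** All forms but the last, [G], define the quotient A. Its Hilbert series is that of [r'] complete
    pairs times [qint (a i0)], and [G] has degree [d - a i0]; so [pairs_gap] compares A in degrees
    [a i0] and [d], contradicting [card_box_leq]. *)
Lemma not_spans_large x : (r + r = n.+2)%N -> (2 < r)%N -> (2 < d)%N ->
  (2 * r - 1 < (r - 2) * d)%N ->
  psi_mx (fun l : 'I_n.+1 => degn l) (extended_form x) d \in unitmx ->
  ~ spans x.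
Proof.
move=> Er lt2r lt2d lt_d unit_d sp.
have [r' Er'] : exists r', r = r'.+1 by exists r.-1; lia.
have Er2 : (n.+1 = r + r')%N by lia.
pose i0 : 'I_r := cast_ord (esym Er') ord_max.
pose G := form_ x (rshift r i0).
have ai0 := a_bounds i0.
have hG : G \is (d - a i0).-homog by rewrite -deg_rshift; apply: gform_homog.
have span p : p \is d.-homog -> exists c0, exists c : 'I_n.+1 -> {mpoly K[n.+1]},
    p = c0 * G + \sum_l c l * extended_form x l.
  move=> hp; have [c ->] := sp _ hp; exists (c (rshift r i0)).
  exists (fun l => oapp c 0 (insub (l : nat))).
  pose T (l : nat) : {mpoly K[n.+1]} := oapp (fun k => c k * form_ x k) 0 (insub l).
  rewrite [X in _ = _ + X](_ : _ = \sum_(l < n.+1) T l); last first.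
    apply: eq_bigr => l _; rewrite /T /extended_form; case: insub => //=.
    by rewrite mul0r.
  rewrite (eq_bigr (fun l : 'I_(r + r) => T l)) => [|l _]; last by rewrite /T valK.
  rewrite Er big_ord_recr /= addrC; congr (_ + _).
  apply: etrans (congr1 T (Er2 : n.+1 = rshift r i0)) _.
  by rewrite /T valK.
have := card_box_leq (fun l => degn_gt0 l) (extended_form_homog x) unit_d
  (leqnn d) (leq_subr _ _) hG span.
rewrite subKn; last by case/andP: ai0 => _ /ltnW.
rewrite leqNgt => /negP; apply; rewrite -ltz_nat !card_box.
have lt_i (i : 'I_r') : (i < r)%N by rewrite Er' ltnW // ltnS.
pose aw i := a (Ordinal (lt_i i)).
have -> : \prod_(l < n.+1) qint (degn l) = pairs d aw * qint (a i0).
  have -> : n.+1 = (r'.+1 + r')%N by rewrite Er2 Er'.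
  rewrite big_split_ord big_ord_recr /= mulrAC -big_split /=.
  congr (_ * qint _); last by rewrite -(degn_lshift i0).
  apply: eq_bigr => i _; congr (_ * _); apply: congr1.
    exact: degn_lshift (Ordinal (lt_i i)).
  by rewrite -Er'; apply: degn_rshift (Ordinal (lt_i i)).
apply: pairs_gap => //; last by move=> i; apply: a_bounds.
(* [2 r <= (r - 2) d] is equivalent to [d + 2 <= (r - 1) (d - 2)]. *)
move: lt_d; rewrite Er'; nia.
Qed.

(* Terracini's criterion at an explicit point: all forms but the last are powers
   of the variables and the last one, when there are [n.+2] forms, is a power of
   the sum of the variables. *)
Lemma spanning_point :
  ((r + r)%N = n.+1 /\ (r * (d - 2) < d)%N) \/
  ((r + r)%N = n.+2 /\ ((r - 2) * d <= 2 * r - 1)%N) -> exists x, spans x.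
Proof.
move=> cases.
pose base (l : nat) : {mpoly K[n.+1]} := oapp (fun i => 'X_i) (ell K n.+1) (insub l).
have base_homog l : base l \is 1.-homog.
  rewrite /base; case: insub => /= [i|]; last exact: ell_homog.
  by rewrite dhomogX /= mdeg1.
have hG (k : 'I_(r + r)) : base k ^+ deg k \is (deg k).-homog.
  by have := dhomogMn (deg k) (base_homog k); rewrite mul1n.
have [x xP] := gform_surj deg_leq hG; exists x => p hp.
suff [c ->] : exists c : nat -> {mpoly K[n.+1]},
    p = \sum_(l < r + r) c l * base l ^+ degn l.
  by exists (fun l => c l); apply: eq_bigr => l _; rewrite xP degnE.
have hX (l : 'I_n.+1) : ('X_l ^+ degn l : {mpoly K[n.+1]}) \is (degn l).-homog.
  by rewrite mpolyXn dhomogX /= mdegMn mdeg1 mul1n.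
have baseE (l : 'I_n.+1) : base l = 'X_l by rewrite /base valK.
case: cases => -[Er le_d].
  have [q [c [_ _ ->]]] := Psi_box_part (fun l : 'I_n.+1 => degn_gt0 l) hX hp.
  rewrite (_ : Psi _ _ p = p); last first.
    by rewrite [RHS]mpolyE; apply: eq_bigr => m _; rewrite psi_monX.
  rewrite big1 ?add0r => [->|m]; last first.
    rewrite inE => /andP [/eqP dm /forallP ltm]; exfalso.
    suff : (d <= r * (d - 2))%N by rewrite leqNgt le_d.
    rewrite -sum_degn Er -dm mdegE; apply: leq_sum => l _.
    by have := ltm l; have := degn_gt0 l; lia.
  exists (fun l => oapp c 0 (insub l)); rewrite Er; apply: eq_bigr => l _.
  by rewrite valK baseE.
have lt_last : (n.+1 < r + r)%N by rewrite Er.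
have := deg_bounds (Ordinal lt_last); rewrite -degnE /= => bnd.
have s_eq : (socle_degree (fun l : 'I_n.+1 => degn l) + (degn n.+1).-1 = r * (d - 2))%N.
  by rewrite -sum_degn Er big_ord_recr.
have [||c0 [c ->]] := @lefschetz K _ (fun l : 'I_n.+1 => degn l)
  (fun l => degn_gt0 l) d (degn n.+1) p _ _ hp.
- by move: bnd; lia.
- by move: le_d s_eq bnd Er; nia.
exists (fun l => oapp c c0 (insub l)).
rewrite Er [RHS]big_ord_recr /= [RHS]addrC.
have insub_last : insub n.+1 = None :> option 'I_n.+1 by rewrite insubN ?ltnn.
rewrite [base n.+1]/(oapp _ _ _) !insub_last /=; apply: (congr1 (+%R _)).
apply: eq_bigr => l _; rewrite baseE.
by rewrite (_ : insub _ = Some l) //; apply: valK.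
Qed.

(** The remaining variables complete the F_i to one form per variable, and [J] is taken just above
    the socle degree, as [regular_power_basis] requires. *)
Lemma regular_generic : (r <= n)%N -> exists2 h : {mpoly K[N]}, h != 0 &
  forall x, h.@[x] != 0 -> regular_sequence (fun i => form_ x (lshift r i)).
Proof.
move=> le_rn.
have hG (k : 'I_(r + r)) :
    (oapp (fun i : 'I_n.+1 => 'X_i ^+ deg k) 0 (insub (k : nat)) : {mpoly K[n.+1]})
      \is (deg k).-homog.
  case: insub => /= [i|]; last exact: rpred0.
  by rewrite mpolyXn dhomogX /= mdegMn mdeg1 mul1n.
have [x0 x0P] := gform_surj deg_leq hG.
pose e (l : 'I_n.+1) : nat := oapp a 1%N (insub (l : nat)).
pose H x (l : 'I_n.+1) : {mpoly K[n.+1]} :=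
  oapp (fun i => form_ x (lshift r i)) 'X_l (insub (l : nat)).
have e_gt0 l : (0 < e l)%N.
  by rewrite /e; case: insub => //= i; case/andP: (a_bounds i).
have H_homog x l : H x l \is (e l).-homog.
  rewrite /H /e; case: insub => /= [i|]; last by rewrite dhomogX /= mdeg1.
  by rewrite -deg_lshift; apply: gform_homog.
have [||h nz_h hP] := @det_psi_generic e (\sum_l (e l).-1).+1 H x0.
- move=> l; rewrite /H; case: insub => /= [i|]; last exact: polyfam_const.
  exact: gform_polyfam.
- move=> l; rewrite /H /e; case: insubP => //= i _ iE.
  by rewrite x0P deg_lshift /= iE valK.
exists h => // x /hP unit_x.
have le_r : (r <= n.+1)%N by apply: leqW.
have := regular_power_basis e_gt0 (H_homog x) (iota := widen_ord le_r) unit_x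
  (ltnSn _).
rewrite (_ : (fun i => H x (widen_ord le_r i)) = fun i => form_ x (lshift r i)).
  by apply=> i j /(congr1 val) /= /val_inj.
apply/funext => i; rewrite /H (_ : insub _ = Some i) //.
exact: valK.
Qed.

Lemma form_of_coefs (y : 'I_#|form_monomial n d| -> K) :
  exists F : dhomog n.+1 K d, form_coef F =1 y.
Proof.
have hF : \sum_i y i *: 'X_[fmon i] \is d.-homog.
  by apply: rpred_sum => i _; apply: dhomogZ; rewrite dhomogX /= mdeg_fmon.
exists (DHomog hF) => i; rewrite /form_coef -/(fmon i) /= raddf_sum (bigD1 i) //=.
rewrite mcoeffZ mcoeffX eqxx mulr1 big1 ?addr0 // => j ji.
by rewrite mcoeffZ mcoeffX (inj_eq fmon_inj) (negbTE ji) mulr0.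
Qed.

(** Points of the projective space are nonzero forms; multiplying [p] by a coordinate ['X_i0]
    excludes the zero form. *)
Lemma nonzero_form_point (p : {mpoly K[#|form_monomial n d|]}) : p != 0 ->
  exists F : dhomog n.+1 K d, F != 0 /\ p.@[form_coef F] != 0.
Proof.
move=> nz_p; have [|i0 _] := @fmon_surj (U_(ord0) *+ d)%MM.
  by rewrite mdegMn mdeg1 mul1n.
have nz_X : ('X_i0 : {mpoly K[#|form_monomial n d|]}) != 0.
  by rewrite -msize_poly_eq0 msizeX.
have [y] := mpoly_neq0_point (mulf_neq0 nz_p nz_X).
rewrite mevalM mevalXU mulf_eq0 negb_or => /andP [py yi0].
have [F Fy] := form_of_coefs y; exists F; split.
  by apply: contraNneq yi0 => F0; rewrite -Fy F0 /form_coef mcoeff0.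
by rewrite (meval_eq _ Fy).
Qed.

Lemma homog_meval_scale k m (p : {mpoly K[m]}) t (y : 'I_m -> K) :
  p \is k.-homog -> p.@[fun i => t * y i] = t ^+ k * p.@[y].
Proof.
move=> hp; rewrite !mevalE mulr_sumr big_seq [RHS]big_seq; apply: eq_bigr => e e_p.
have <- : mdeg e = k by apply: (dhomog_mf hp).
rewrite [RHS]mulrCA; congr (_ * _); rewrite mdegE expr_sum -big_split.
by apply: eq_bigr => i _; rewrite exprMn.
Qed.

(** The set where [c] is nonzero need not be a cone, so [U] is defined by the homogeneous components
    of [c]. For [F] in [U], [c] is a nonzero polynomial in [t] along t F, hence some t F with
    [t != 0] lies in the image; dividing the G_i by [t] gives [F]. *)
Lemma spans_generic_contains_CI : (r <= n)%N -> (exists x, spans x) ->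
  generic_contains_CI K n d a.
Proof.
move=> le_rn [x0 sp]; have [q qE] := product_map.
have [h nz_h hP] := regular_generic le_rn.
have [c nz_c cP] := dominant_image_open (spans_row_free qE sp) nz_h.
have c_split : c = \sum_(k < msize c) pihomog mdeg k c.
  by apply: pihomog_partitionE; apply: leqnn.
pose E e := exists k, e = pihomog mdeg k c.
exists (fun F => exists2 e, E e & e.@[form_coef F] != 0); split.
- by exists E => // e [k ->]; exists k; apply: pihomogP.
- have [F [nz_F cF]] := nonzero_form_point nz_c; exists F => //.
  apply: contrapT => all0; case/eqP: cF; rewrite c_split raddf_sum big1 //= => k _.
  apply/eqP; apply: contrapT => /negP nz_k; apply: all0.
  by exists (pihomog mdeg k c) => //; exists k.
move=> F nz_F [_ [k ->] nz_k]; set y := form_coef F in nz_k.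
pose Q := \poly_(l < msize c) (pihomog mdeg l c).@[y].
have QE t : Q.[t] = c.@[fun i => t * y i].
  rewrite horner_poly [in RHS]c_split raddf_sum; apply: eq_bigr => l _ /=.
  by rewrite (homog_meval_scale _ _ (pihomogP _ _ _)) mulrC.
have [t nz_t ct] : exists2 t, t != 0 & c.@[fun i => t * y i] != 0.
  apply: contrapT => all0.
  (* The factor ['X] takes care of [t = 0], where the assumption says nothing about [c]. *)
  have QX0 : Q * 'X = 0.
    apply: poly_vanish => t; rewrite hornerM hornerX QE.
    have [->|nz_t] := eqVneq t 0; first by rewrite mulr0.
    apply/eqP; rewrite mulf_eq0; apply/orP; left.
    by apply: contrapT => /negP ct; apply: all0; exists t.
  have Q0 : Q = 0 by apply/eqP; move/eqP: QX0; rewrite mulf_eq0 polyX_eq0 orbF.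
  case/negP: nz_k; have [lt_k|le_k] := ltnP k (msize c).
    by have /polyP/(_ k) := Q0; rewrite coef_poly lt_k coef0 => ->.
  suff -> : pihomog mdeg k c = 0 by rewrite meval0.
  rewrite c_split linear_sum big1 //= => l _.
  rewrite (pihomog_ne0 _ (pihomogP _ l c)) //.
  by rewrite neq_ltn (leq_trans (ltn_ord l) le_k).
have [x xP hx] := cP _ ct.
have bilE : bil x x = t *: (F : {mpoly K[n.+1]}).
  apply: homog_eq_fmon; first exact: bil_homog.
    by apply: dhomogZ; apply: dhomog_is_dhomog.
  by move=> i; rewrite -qE xP mcoeffZ.
exists (in_ideal (fun i => form_ x (lshift r i))).
  exists (fun i => form_ x (lshift r i)); split=> // [i|]; last exact: hP.
  by rewrite -deg_lshift; apply: gform_homog.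
exists (fun i => t^-1 *: form_ x (rshift r i)).
rewrite -[LHS]scale1r -(mulVf nz_t) -scalerA -bilE scaler_sumr.
by apply: eq_bigr => i _; rewrite -scalerAl mulrC.
Qed.

(** A relation [p] between the coefficients, multiplied by an equation [e] of the open set, would be
    nonzero at some form [F] of that set; but [F] is a value of the product map, where [p]
    vanishes. *)
Lemma generic_contains_CI_spans : generic_contains_CI K n d a ->
  exists2 x, spans x &
    psi_mx (fun l : 'I_n.+1 => degn l) (extended_form x) d \in unitmx.
Proof.
move=> [U [[E Ehom EU] [F0 nz_F0 /(EU _ nz_F0) [e Ee nz_e]] U_CI]].
have [q qE] := product_map.
suff q_indep : alg_indep q.
  by have [x0 /(generic_spanning qE)] := alg_indep_jacobian q_indep.
move=> p qp; apply/eqP; apply: contraT => nz_p.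
have nz_e' : e != 0 by apply: contraNneq nz_e => ->; rewrite meval0.
have [F [nz_F]] := nonzero_form_point (mulf_neq0 nz_p nz_e').
rewrite mevalM mulf_eq0 negb_or => /andP [pF eF].
have [|I [Fs [hFs _ IE]] /IE [c ec]] := U_CI F nz_F.
  by apply/(EU _ nz_F); exists e.
have hF : (F : {mpoly K[n.+1]}) \is d.-homog by apply: dhomog_is_dhomog.
have := hspan_pihomog hFs d c; rewrite -ec pihomog_dE // => -[c' [hc' _ ec']].
pose G l := match split l with inl i => Fs i | inr i => c' i end.
have hG l : G l \is (deg l).-homog by rewrite /G /deg; case: split => i.
have [x xP] := gform_surj deg_leq hG.
have bilF : bil x x = F.
  rewrite ec'; apply: eq_bigr => i _; rewrite !xP /G.
  rewrite (unsplitK (inl i : 'I_r + 'I_r)) (unsplitK (inr i : 'I_r + 'I_r)).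
  by rewrite mulrC.
case/negP: pF; apply/eqP.
have := congr1 (meval x) qp; rewrite meval0 meval_mcomp => <-.
by apply: meval_eq => i; rewrite qE bilF.
Qed.

End Assembly.

(* The numerical case analysis *)
Local Close Scope ring_scope.

Theorem theorem5p1 (R : realType) (n d r : nat) (a : 'I_r -> nat)
  (hn : 1 < n) (hd : 1 < d) (hr : 1 <= r) (hrn : 2 * r <= n + 2)
  (ha : forall i : 'I_r, 0 < a i /\ a i < d) :
  @generic_contains_CI (complex R) n d r a <->
    (n = 2 /\ r = 2) \/
    (n = 3 /\ r = 2 /\ d <= 3) \/
    (n = 4 /\ r = 3 /\ d <= 5) \/
    (((n = 6 /\ r = 4) \/ (n = 8 /\ r = 5)) /\ d <= 3) \/
    ((n = 5 \/ n = 7 \/ 8 < n) /\ (2 * r = n + 1 \/ 2 * r = n + 2) /\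
       d = 2 /\ (forall i : 'I_r, a i = 1)).
Proof.
have a_bounds i : 0 < a i < d by apply/andP; apply: ha.
split=> [gen|cases].
  have [x sp unit_x] := @generic_contains_CI_spans (complex R) n d r a a_bounds gen.
  have small : r + r <= n.+1 -> ~ d <= \sum_(l < n.+1) (degn d a l).-1.
    by move=> le_r le_d; apply: (not_spans_small a_bounds le_r le_d unit_x sp).
  have not_less : ~ r + r <= n.
    move=> le_r; apply: small; first exact: leqW.
    (* The index [n] lies outside ['I_(r + r)], so its degree is the default [d.+1], which
       contributes [d] on its own. *)
    rewrite big_ord_recr /= [degn d a n]/(oapp _ _ _) insubN /=.
      exact: leq_addl.
    by rewrite -leqNgt.
  have equal : r + r = n.+1 -> r * (d - 2) < d.
    move=> Er; rewrite ltnNge; apply/negP => le_d; apply: small.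
      by rewrite Er.
    by rewrite -Er (sum_degn a_bounds).
  have large : r + r = n.+2 -> 2 < r -> 2 < d -> (r - 2) * d <= 2 * r - 1.
    move=> Er lt2r lt2d; rewrite leqNgt; apply/negP => lt_d.
    exact: (not_spans_large a_bounds Er lt2r lt2d lt_d unit_x sp).
  have a1 : d = 2 -> forall i, a i = 1.
    by move=> d2 i; have := a_bounds i; rewrite d2; lia.
  have [Er|Er] : r + r = n.+1 \/ r + r = n.+2 by lia.
    have {}equal := equal Er.
    have [r2|lt2r] : r = 2 \/ 2 < r by lia.
      by right; left; move: equal; rewrite r2; lia.
    (* [r >= 3] and [r * (d - 2) < d] leave only [d = 2]. *)
    have d2 : d = 2 by nia.
    by do 4!right; split; [lia|split; [lia|split=> //; apply: a1]].
  have {}large := large Er.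
  have [r2|lt2r] : r = 2 \/ 2 < r by lia.
    by left; lia.
  have {}large := large lt2r.
  (* The bound reads [d <= 2 + 3 / (r - 2)]: at most [5], [3], [3] for [r = 3], [4], [5], and below
     [3] for larger [r]. *)
  have [r3|[r4|[r5|lt5r]]] : r = 3 \/ r = 4 \/ r = 5 \/ 5 < r by lia.
  - by right; right; left; move: large; rewrite r3; lia.
  - by do 3!right; left; move: large; rewrite r4; lia.
  - by do 3!right; left; move: large; rewrite r5; lia.
  have d2 : d = 2 by nia.
  by do 4!right; split; [lia|split; [lia|split=> //; apply: a1]].
apply: spans_generic_contains_CI => //; first lia.
apply: spanning_point => //.
case: cases => [[n2 r2]|[[n3 [r2 d3]]|[[n4 [r3 d5]]|[[nr d3]|[nr [rn [d2 _]]]]]]].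
- by right; split; [lia|rewrite r2].
- by left; split; [lia|rewrite r2; lia].
- by right; split; [lia|rewrite r3; lia].
- by right; case: nr => -[n_ r_]; split; rewrite ?r_; lia.
- case: rn => rn; [left|right]; split; rewrite ?d2; lia.
Qed.
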